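(* Assume that $Z_{2n}\stackrel{d}{=}Z_n+I$ for all $n\ge1$, where $I\sim\mathrm{Bernoulli}(1/2)$ is independent of $Z_n$. Then $Z_n$ is asymptotically normally distributed: as $n\to\infty$, $$\mathbb{P}\left(Z_n=\left\lfloor\frac{\lambda}{2}+x\frac{\sqrt{\lambda}}{2}\right\rfloor\right)=\frac{\sqrt{2}\,e^{-x^2/2}}{\sqrt{\pi\lambda}}\left(1+O\left(\frac{1+|x|^3}{\sqrt{\lambda}}\right)\right),$$ uniformly for $x=o(\lambda^{1/6})$, with mean and variance satisfying $$\mathbb{E}(Z_n)=\frac{\log_2 n}{2}+G_1(\log_2 n),\qquad \mathbb{V}(Z_n)=\frac{\log_2 n}{4}+G_2(\log_2 n),$$ where $G_1,G_2$ are bounded periodic functions (of period $1$).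
   Context: Each nonnegative integer is encoded by a different binary string; $\mu(j)$ denotes the number of 1s in the string encoding $j$. For $n\ge1$, $Z_n$ is the random variable $\mu(U_n)$ with $U_n$ uniform on $\{0,1,\ldots,n-1\}$, i.e. $\mathbb{P}(Z_n=k)=\frac1n\#\{0\le j<n:\mu(j)=k\}$. By convention $Z_0=Z_1=0$ (so $\mu(0)=0$). $\lambda=\lfloor\log_2 n\rfloor$. *)

(* Defs.v *)
From HB Require Import structures.
From mathcomp Require Import all_boot all_order all_algebra.
From mathcomp Require Import all_classical all_reals all_analysis.

Set Implicit Arguments.
Unset Strict Implicit.
Unset Printing Implicit Defensive.

Import Order.TTheory GRing.Theory Num.Theory.
Import numFieldNormedType.Exports.

Local Open Scope classical_set_scope.
Local Open Scope ring_scope.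

Definition log2 (R : realType) (x : R) : R := ln x / ln 2.

Definition lam (R : realType) (n : nat) : R := (Num.floor (log2 (n%:R : R)))%:~R.

Definition mu (enc : nat -> seq bool) (j : nat) : nat := count_mem true (enc j).

Section RandomVariables.
Context d (Omega : measurableType d) (R : realType) (P : probability Omega R).

Definition uniform_below (n : nat) (X : {RV P >-> nat}) : Prop :=
  forall j : nat,
    P [set w | X w = j] = (if (j < n)%N then n%:R^-1 else 0 : R)%:E.

Definition eq_in_distribution d' (T : measurableType d') (X Y : Omega -> T) : Prop :=
  forall A : set T, measurable A -> P (X @^-1` A) = P (Y @^-1` A).

Definition independent_RVs d1 d2 (T1 : measurableType d1) (T2 : measurableType d2)
    (X : Omega -> T1) (Y : Omega -> T2) : Prop :=
  forall (A : set T1) (B : set T2), measurable A -> measurable B ->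
    P (X @^-1` A `&` Y @^-1` B) = (P (X @^-1` A) * P (Y @^-1` B))%E.

(* Nothing is sampled for n = 0, where the value of Z is set to 0. *)
Definition Z (enc : nat -> seq bool) (U : nat -> {RV P >-> nat}) (n : nat)
    (w : Omega) : nat :=
  if n is 0 then 0%N else mu enc (U n w).

End RandomVariables.
Arguments eq_in_distribution {d Omega R} P {d' T} X Y.
Arguments independent_RVs {d Omega R} P {d1 d2 T1 T2} X Y.

(* The leading term of the local limit formula. *)
Definition local_gauss (R : realType) (n : nat) (x : R) : R :=
  Num.sqrt 2 * expR (- x ^+ 2 / 2) / Num.sqrt (pi * lam R n).

(* Main.v *)
Require Import Defs.
From HB Require Import structures.
From mathcomp Require Import all_boot all_order all_algebra.
From mathcomp Require Import all_classical all_reals all_analysis.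
From mathcomp Require Import measurable_realfun.
From mathcomp Require Import ring lra zify.

Import Order.TTheory GRing.Theory Num.Theory.
Import numFieldNormedType.Exports.

Local Open Scope classical_set_scope.
Local Open Scope ring_scope.

(** Write [m j] for the number of ones in the code of [j].  The doubling
hypothesis, taken at [n + 1] and at [n] and subtracted, says that the codes of
[2 n] and [2 n + 1] have [m n] and [m n + 1] ones in some order
([splits_mu]).  Iterating, over a dyadic block of length [2 ^ L] starting at
[q 2 ^ L] the statistic [m] is distributed as [m q] plus a binomial variable
with parameters [L] and 1/2 ([prefix_full]).

An interval [0, n) with [n <= 2 ^ l] is a disjoint union of such blocks, at
most one of each length [2 ^ (l - d)], and for the block at depth [d] one only
knows that [m q <= d].  Suppose that the average of a function of [m] over any
block of depth [d] is within [e d] of a fixed number.  As that block has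
relative weight of order [2 ^ - d] when [n] is comparable to [2 ^ l], the
average over [0, n) is within a constant times the sum of the [2 ^ - d * e d]
of the same number, which is a good bound as soon as [e] grows slower than
[2 ^ d].  This principle is [prefix_bound]; it is used three times.

- For [i - l / 2] and [(i - l / 2) ^ 2 - l / 4] it gives mean and variance up
  to [O(1)] ([moments_bound]).  The bounded remainders are unchanged when [n]
  is doubled, so they depend only on the fractional part of [log2 n]
  ([periodic_interpolation]).
- For the indicator of [k] minus a binomial probability it shows that the
  frequency of [k] among [m 0, ..., m (n - 1)] is a binomial probability up to
  a relative error of the order of the distance of [k] from the centre
  divided by [l] ([occurrences_near_bpmf]); the ratios of neighbouring
  binomial probabilities needed here are computed in [bpmf_near].

The binomial probabilities themselves are compared with a Gaussian by adding
the logarithms of successive ratios from the centre outwards ([bpmf_log]); a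
quadratic error for the logarithm suffices, and produces the cubic error term
of the local formula.  The central binomial probabilities are asymptotic to
[sqrt (kappa / m)] for some [kappa > 0], by monotonicity
([central_asymp]), so the local formula holds with an unknown constant
([local_limit_up_to_constant]).

The constant is found by normalization: summing the local formula over a
window compares the frequencies with the normal distribution function
([window_estimate]), while Chebyshev's inequality, fed with the second moment
bound above, shows that no mass escapes ([normalization]).  The same window
estimate then gives the central limit theorem ([counting_clt]). *)

(** * Dyadic blocks *)

(** The pointwise form of the doubling rule.  Both orders must be allowed, since
the encoding is not the usual binary one. *)
Definition splits (m : nat -> nat) := forall n : nat,
  (m n.*2 = m n /\ m n.*2.+1 = (m n).+1) \/
  (m n.*2 = (m n).+1 /\ m n.*2.+1 = m n).

Section Blocks.
Context {R : realType}.
Implicit Types (f : nat -> R) (m : nat -> nat).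

(** The unfolded form of the sum over [i] of [binomial(L, i) * f (c + i)]:
one block of length [2 ^ L] is two blocks of half that length, whose codes
have [c] and [c + 1] ones at the start. *)
Fixpoint walk f (L c : nat) : R :=
  if L is L'.+1 then walk f L' c + walk f L' c.+1 else f c.

Definition prefix f m (L q r : nat) : R := \sum_(0 <= i < r) f (m (q * 2 ^ L + i)%N).

Lemma prefix_cat f m L q r1 r2 :
  prefix f m L q (r1 + r2) =
  prefix f m L q r1 + \sum_(0 <= i < r2) f (m (q * 2 ^ L + r1 + i)%N).
Proof.
rewrite /prefix (@big_cat_nat _ _ _ r1)//=; last exact: leq_addr.
congr (_ + _); rewrite -{1}[r1]add0n big_addn addKn.
by apply: eq_bigr => i _; rewrite -addnA (addnC i).
Qed.

Lemma prefix_left f m L q r : prefix f m L.+1 q r = prefix f m L q.*2 r.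
Proof.
by apply: eq_bigr => i _; rewrite expnS mulnA muln2.
Qed.

Lemma prefix_right f m L q r :
  prefix f m L.+1 q (2 ^ L + r) =
  prefix f m L q.*2 (2 ^ L) + prefix f m L q.*2.+1 r.
Proof.
rewrite prefix_cat prefix_left; congr (_ + _); apply: eq_bigr => i _.
by rewrite expnS mulnA muln2 mulSn (addnC (2 ^ L)%N).
Qed.

(** The order in which the two halves take the values [m q] and [m q + 1] is
unknown, but a sum over the whole block does not see it. *)
Lemma prefix_full f m L q : splits m -> prefix f m L q (2 ^ L) = walk f L (m q).
Proof.
move=> sm; elim: L q => [|L IH] q.
  by rewrite /prefix expn0 big_nat1 muln1 addn0.
rewrite expnS mul2n -addnn prefix_right !IH /=.
by case: (sm q) => -[-> ->]; rewrite // addrC.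
Qed.

(** A proper prefix of a block either lies in its left half, or is the full
left half followed by a prefix of the right half.  Each step down therefore
costs at most one full block, so a bound [H] for prefixes propagates upwards
as soon as its increments dominate the full blocks.  The restriction
[m q <= l - L] records that one step down adds at most one to [m q]; at level
[L0] the induction starts from a bound found by other means. *)
Lemma prefix_bound f m (l L0 : nat) (H : nat -> R) :
  splits m ->
  (forall q r, (m q <= l - L0)%N -> (r <= 2 ^ L0)%N -> `|prefix f m L0 q r| <= H L0) ->
  (forall L c, (L0 <= L < l)%N -> (c <= l - L)%N -> `|walk f L c| + H L <= H L.+1) ->
  forall L q r, (L0 <= L <= l)%N -> (m q <= l - L)%N -> (r <= 2 ^ L)%N ->
  `|prefix f m L q r| <= H L.
Proof.
move=> sm H0 HS; elim=> [|L IH] q r.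
  by rewrite leqn0 => /andP[/eqP e _]; move: H0; rewrite e; apply.
move=> /andP[]; rewrite leq_eqVlt => /predU1P[e _|]; first by move: H0; rewrite e; apply.
rewrite ltnS => L0L Ll mq rL.
have [mq2 mq21] : (m q.*2 <= l - L)%N /\ (m q.*2.+1 <= l - L)%N.
  by case: (sm q) => -[-> ->]; split; lia.
have L0Ll : (L0 <= L <= l)%N by lia.
have L0Ll' : (L0 <= L < l)%N by lia.
have HLS := HS L _ L0Ll' mq2.
have [rle|rgt] := leqP r (2 ^ L)%N.
  rewrite prefix_left (le_trans (IH _ _ L0Ll mq2 rle))// (le_trans _ HLS)//.
  by rewrite lerDr.
rewrite -(subnKC (ltnW rgt)) prefix_right prefix_full//.
rewrite (le_trans (ler_normD _ _))// (le_trans _ HLS)// lerD2l.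
apply: IH => //; move: rL; rewrite expnS; lia.
Qed.

Lemma walk_shift f g a L c : (forall i, f i = g i + a) ->
  walk f L c = walk g L c + 2 ^+ L * a.
Proof.
move=> fg; elim: L c => [|L IH] c /=; first by rewrite fg expr0 mul1r.
by rewrite !IH exprS; ring.
Qed.

Lemma walk_delta (k L c : nat) : (c <= k)%N ->
  walk (fun i => (i == k)%:R) L c = 'C(L, k - c)%:R.
Proof.
elim: L c => [|L IH] c ck /=.
  by rewrite bin0n subn_eq0 eqn_leq ck.
rewrite IH//; have [ck'|kc] := ltnP c k.
  by rewrite IH// -(subnSK ck') binS natrD addrC.
have {ck kc} -> : c = k by apply/eqP; rewrite eqn_leq ck.
suff walk0 c' : (k < c')%N -> walk (fun i => (i == k)%:R) L c' = 0.
  by rewrite subnn !bin0 walk0 ?addr0.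
elim: L c' {IH} => [|L IH] c' kc' /=; last by rewrite !IH ?addr0// ltnW.
by rewrite gtn_eqF.
Qed.

Lemma walk_linear (a : R) L c :
  walk (fun i => i%:R - a) L c = 2 ^+ L * (c%:R + L%:R / 2 - a).
Proof.
elim: L c => [|L IH] c /=; first by rewrite expr0; ring.
rewrite !IH exprS -(natr1 L) -(natr1 c); by field.
Qed.

Lemma walk_square (a : R) L c :
  walk (fun i => (i%:R - a) ^+ 2) L c =
  2 ^+ L * ((c%:R + L%:R / 2 - a) ^+ 2 + L%:R / 4).
Proof.
elim: L c => [|L IH] c /=; first by rewrite expr0; by field.
rewrite !IH [2 ^+ L.+1]exprS -(natr1 L) -(natr1 c); by field.
Qed.

End Blocks.

(** * Binomial probabilities near the centre *)

Section LogBounds.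
Context {R : realType}.
Implicit Types x y : R.

(** Both bounds come from [ln (1 + y) <= y], the lower one applied to the
inverse of [1 + y]. *)
Lemma ln1D_approx y : `|y| <= 2^-1 -> `|ln (1 + y) - y| <= 2 * y ^+ 2.
Proof.
rewrite ler_norml => /andP[y1 y2].
have y0 : 0 < 1 + y by lra.
have u : ln (1 + y) <= y by apply: le_ln1Dx; lra.
have e : (1 + y)^-1 = 1 + (- y / (1 + y)) by field; lra.
have l : - ln (1 + y) <= - y / (1 + y).
  rewrite -lnV ?posrE// [X in ln X]e; apply: le_ln1Dx.
  by rewrite ltr_pdivlMr//; lra.
have l2 : - y / (1 + y) <= - y + 2 * y ^+ 2.
  rewrite ler_pdivrMr//; nra.
have := sqr_ge0 y; rewrite ler_norml => y3; apply/andP; split; lra.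
Qed.

End LogBounds.

Section Binomial.
Context {R : realType}.

Definition bpmf (l k : nat) : R := 'C(l, k)%:R / 2 ^+ l.

Lemma bpmf_ge0 l k : 0 <= bpmf l k.
Proof. by rewrite divr_ge0// exprn_ge0. Qed.

(** Passing from [l + 1] to [l] steps of the walk multiplies the probability
by one minus or plus the relative drift, according to the last step; this
lemma and [bpmf_step] are the two cases. *)
Lemma bpmf_stay l k :
  bpmf l k = bpmf l.+1 k * (1 - (2 * k%:R - l.+1%:R) / l.+1%:R).
Proof.
have l0 : (2 : R) ^+ l != 0 by rewrite expf_neq0.
have lS : l.+1%:R != 0 :> R by rewrite pnatr_eq0.
suff : l.+1%:R * 'C(l, k)%:R = (l.+1%:R - k%:R) * 'C(l.+1, k)%:R :> R.
  rewrite /bpmf exprS => e.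
  have -> : 'C(l, k)%:R = (l.+1%:R - k%:R) * 'C(l.+1, k)%:R / l.+1%:R :> R.
    by rewrite -e mulrAC mulfV// mul1r.
  by field; rewrite l0 andbT addrC natr1.
have [kl|lk] := leqP k l.+1; last by rewrite !bin_small ?mulr0//; lia.
by rewrite -natrB// -!natrM (mul_bin_down l.+1).
Qed.

Lemma bpmf_step l k :
  bpmf l k = bpmf l.+1 k.+1 * (1 + (2 * k.+1%:R - l.+1%:R) / l.+1%:R).
Proof.
have l0 : (2 : R) ^+ l != 0 by rewrite expf_neq0.
have lS : l.+1%:R != 0 :> R by rewrite pnatr_eq0.
have e : l.+1%:R * 'C(l, k)%:R = k.+1%:R * 'C(l.+1, k.+1)%:R :> R.
  by rewrite -!natrM (mul_bin_diag l.+1).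
have -> : bpmf l k = k.+1%:R * 'C(l.+1, k.+1)%:R / l.+1%:R / 2 ^+ l.
  by rewrite -e [_ * 'C(_, _)%:R]mulrC mulfK.
by rewrite /bpmf exprS; field; rewrite l0 andbT addrC natr1.
Qed.

(** Each of the [d] removed steps multiplies the probability by a factor within
[rho] of 1, because the drift changes by at most one per step. *)
Lemma bpmf_near (rho : R) l d k c : 0 <= rho -> (c <= d)%N -> (c <= k)%N ->
  (d < l)%N -> `|2 * k%:R - l%:R| + d%:R <= rho * (l%:R - d%:R) ->
  `|bpmf (l - d) (k - c) - bpmf l k| <= ((1 + rho) ^+ d - 1) * bpmf l k.
Proof.
move=> rho0; set t := 2 * k%:R - l%:R.
elim: d c => [|d IH] c cd ck dl H.
  move: cd; rewrite leqn0 => /eqP->.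
  by rewrite !subn0 subrr normr0 expr0 subrr mul0r.
have H' : `|t| + d%:R <= rho * (l%:R - d%:R).
  by move: H; rewrite -natr1; nra.
(* One more step, with relative change [del], multiplies the bound by [1 + rho]. *)
have step (X del : R) : `|X - bpmf l k| <= ((1 + rho) ^+ d - 1) * bpmf l k ->
    `|del| <= rho -> `|X * (1 + del) - bpmf l k| <= ((1 + rho) ^+ d.+1 - 1) * bpmf l k.
  move=> HX Hdel.
  have -> : X * (1 + del) - bpmf l k = (X - bpmf l k) + X * del by ring.
  rewrite (le_trans (ler_normD _ _))// normrM.
  have bX : `|X| <= (1 + rho) ^+ d * bpmf l k.
    rewrite -[X](subrK (bpmf l k)) (le_trans (ler_normD _ _))//.
    rewrite [X in _ + X]ger0_norm ?bpmf_ge0//; lra.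
  have : `|X| * `|del| <= (1 + rho) ^+ d * bpmf l k * rho.
    by apply: ler_pM.
  by rewrite exprS; lra.
have ld : l%:R - d%:R = (l - d)%:R :> R by rewrite natrB// ltnW// ltnW.
have ldS : (l - d = (l - d.+1).+1)%N by rewrite subnSK// ltnW.
have ld0 : 0 < (l - d)%:R :> R by rewrite ltr0n subn_gt0 ltnW.
have delta (c' : nat) : (c' <= d)%N -> (c' <= k)%N ->
    `|(2 * (k - c')%:R - (l - d)%:R) / (l - d)%:R| <= rho.
  move=> c'd c'k; rewrite normrM [X in _ * X]ger0_norm ?invr_ge0 ?(ltW ld0)//.
  rewrite ler_pdivrMr// -ld; apply: le_trans H'.
  have -> : 2 * (k - c')%:R - (l%:R - d%:R) = t + (d%:R - 2 * c'%:R).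
    by rewrite /t natrB//; ring.
  rewrite (le_trans (ler_normD _ _))// lerD2l ler_norml.
  have c0 : 0 <= c'%:R :> R by [].
  have c1 : c'%:R <= d%:R :> R by rewrite ler_nat.
  by apply/andP; split; lra.
have dl' := ltnW dl.
have [cd'|] := leqP c d.
  rewrite bpmf_stay -ldS -mulNr; apply: step; first exact: IH.
  by rewrite mulNr normrN; exact: delta.
case: c cd ck => // c cd ck cd'.
have kc : (k - c = (k - c.+1).+1)%N by rewrite subnSK.
rewrite bpmf_step -ldS -kc; apply: step; first exact: IH (ltnW ck) _ _.
by apply: delta => //; exact: ltnW.
Qed.

Definition central m : R := bpmf m.*2 m.

Lemma central0 : central 0 = 1.
Proof. by rewrite /central /bpmf bin0 expr0 divr1. Qed.

Lemma centralS m : central m.+1 = central m * ((2 * m%:R + 1) / (2 * m%:R + 2)).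
Proof.
have m0 : 0 <= m%:R :> R by [].
rewrite /central (bpmf_stay m.*2) (bpmf_step m.*2.+1).
rewrite doubleS -(natr1 m) -(natr1 m.*2.+1) -(natr1 m.*2) -mul2n natrM.
by field; lra.
Qed.

Lemma central_gt0 m : 0 < central m.
Proof.
elim: m => [|m IH]; first by rewrite central0.
rewrite centralS mulr_gt0// divr_gt0// ?ltr_wpDl//.
Qed.

(** Together with [central_sqr_decr] this encloses the limit of
[m * central m ^ 2] between two sequences at relative distance [1 / (2 m)],
which yields the asymptotics with a rate and without evaluating the limit. *)
Lemma central_sqr_incr m n : (m <= n)%N ->
  m%:R * central m ^+ 2 <= n%:R * central n ^+ 2.
Proof.
elim: n => [|n IH]; first by rewrite leqn0 => /eqP->.
rewrite leq_eqVlt => /predU1P[->//|/IH /le_trans]; apply.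
rewrite centralS; set q := (X in central n * X).
have -> : n.+1%:R * (central n * q) ^+ 2 = n.+1%:R * q ^+ 2 * central n ^+ 2 by ring.
rewrite ler_wpM2r ?sqr_ge0// /q.
have m0 : 0 <= n%:R :> R by [].
rewrite -natr1 expr_div_n mulrA ler_pdivlMr ?exprn_gt0//; nra.
Qed.

Lemma central_sqr_decr m n : (m <= n)%N ->
  (n%:R + 2^-1) * central n ^+ 2 <= (m%:R + 2^-1) * central m ^+ 2.
Proof.
elim: n => [|n IH]; first by rewrite leqn0 => /eqP->.
rewrite leq_eqVlt => /predU1P[->//|/IH]; apply: le_trans.
rewrite centralS; set q := (X in central n * X).
have -> : (n.+1%:R + 2^-1) * (central n * q) ^+ 2 = (n.+1%:R + 2^-1) * q ^+ 2 * central n ^+ 2.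
  by ring.
rewrite ler_wpM2r ?sqr_ge0// /q.
have m0 : 0 <= n%:R :> R by [].
rewrite -natr1 expr_div_n mulrA ler_pdivrMr ?exprn_gt0//; nra.
Qed.

Lemma central_asymp : exists2 kappa : R, 0 < kappa &
  forall m, (0 < m)%N -> `|ln (central m) - (ln kappa - ln m%:R) / 2| <= (2 * m%:R)^-1.
Proof.
pose E := [set m%:R * central m ^+ 2 | m in [set: nat]].
have ub n : ubound E ((n%:R + 2^-1) * central n ^+ 2).
  move=> _ [m _ <-]; have [mn|/ltnW nm] := leqP m n.
    rewrite (le_trans (central_sqr_incr _ _ mn))// ler_wpM2r ?sqr_ge0//; lra.
  rewrite (le_trans _ (central_sqr_decr _ _ nm))// ler_wpM2r ?sqr_ge0//; lra.
have E0 : E !=set0 by exists (0%:R * central 0 ^+ 2); exists 0%N.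
have Eub : has_ubound E by exists ((0%:R + 2^-1) * central 0 ^+ 2); exact: ub.
have lo m : m%:R * central m ^+ 2 <= sup E by apply: ub_le_sup => //; exists m.
have hi m : sup E <= (m%:R + 2^-1) * central m ^+ 2 by apply: ge_sup.
have k0 : 0 < sup E.
  by apply: lt_le_trans (lo 1%N); rewrite mul1r exprn_gt0// central_gt0.
exists (sup E) => // m m_gt0.
have m0 : 0 < m%:R :> R by rewrite ltr0n.
have c0 := central_gt0 m.
have c20 : 0 < central m ^+ 2 by rewrite exprn_gt0.
have lc : ln (m%:R * central m ^+ 2) = ln m%:R + ln (central m) *+ 2.
  by rewrite lnM ?posrE// lnXn.
have l1 : ln (m%:R * central m ^+ 2) <= ln (sup E).
  by rewrite ler_ln ?posrE// mulr_gt0.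
have l2 : ln (sup E) <= (2 * m%:R)^-1 + ln (m%:R * central m ^+ 2).
  have /le_trans -> // : ln (sup E) <= ln ((m%:R + 2^-1) * central m ^+ 2).
    by rewrite ler_ln ?posrE// mulr_gt0// ltr_wpDl.
  have -> : (m%:R + 2^-1) * central m ^+ 2 = (1 + (2 * m%:R)^-1) * (m%:R * central m ^+ 2).
    by field; lra.
  have i0 : 0 < (2 * m%:R)^-1 :> R by rewrite invr_gt0 mulr_gt0.
  have z0 : 0 < m%:R * central m ^+ 2 by exact: mulr_gt0.
  rewrite [leLHS]lnM ?posrE// ?addr_gt0// lerD2r le_ln1Dx//; lra.
have i0 : 0 < (2 * m%:R)^-1 :> R by rewrite invr_gt0 mulr_gt0.
by move: l1 l2; rewrite lc mulr2n ler_norml => l1 l2; apply/andP; split; lra.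
Qed.

Lemma bin_double_next m j : (j <= m)%N ->
  (m%:R + j%:R + 1) * 'C(m.*2, (m + j).+1)%:R =
  (m%:R - j%:R) * 'C(m.*2, m + j)%:R :> R.
Proof.
move=> jm; rewrite -natrB// -natrD natr1 -!natrM mul_bin_left.
by congr (_ * _)%:R; lia.
Qed.

(** The ratio of neighbouring probabilities is [(1 - u) / (1 + u)] with
[u = (2 j + 1) / (2 m + 1)].  Its logarithm is [- 2 u] up to [4 u ^ 2], and
the sum of the [2 u] is exactly [2 j ^ 2 / (2 m + 1)]. *)
Lemma bpmf_log_right m J j : (j <= J)%N -> (4 * J <= 2 * m)%N ->
  0 < bpmf m.*2 (m + j) /\
  `|ln (bpmf m.*2 (m + j)) - ln (central m) + 2 * j%:R ^+ 2 / (2 * m%:R + 1)|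
    <= 4 * j%:R * (2 * J%:R / (2 * m%:R + 1)) ^+ 2.
Proof.
move=> jJ Jm; elim: j jJ => [_|j IH jJ].
  rewrite addn0 -/(central m) central_gt0; split => //.
  by rewrite subrr expr0n /= !(mulr0, mul0r) addr0 normr0.
have jm : (j <= m)%N by lia.
have [b0 {}IH] := IH (ltnW jJ).
have m0 : 0 <= m%:R :> R by [].
have j0 : 0 <= j%:R :> R by [].
have jJR : j%:R + 1 <= J%:R :> R by rewrite natr1 ler_nat.
have JmR : 4 * J%:R <= 2 * m%:R :> R by rewrite -!natrM ler_nat.
set M := 2 * m%:R + 1 in IH *.
have M0 : 0 < M by rewrite /M; lra.
set tau := 2 * J%:R / M in IH *.
pose u : R := (2 * j%:R + 1) / M.
have u0 : 0 <= u by rewrite divr_ge0//; lra.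
have utau : u <= tau by rewrite ler_pM2r ?invr_gt0//; lra.
have tau2 : tau <= 2^-1 by rewrite ler_pdivrMr// /M; lra.
have e : bpmf m.*2 (m + j.+1) = bpmf m.*2 (m + j) * ((1 - u) / (1 + u)).
  rewrite addnS /bpmf; have e := @bin_double_next m j jm.
  have -> : 'C(m.*2, (m + j).+1)%:R =
     (m%:R - j%:R) * 'C(m.*2, m + j)%:R / (m%:R + j%:R + 1) :> R.
    by rewrite -e mulrAC mulfV ?mul1r//; lra.
  have p0 : 2 ^+ m.*2 != 0 :> R by rewrite expf_neq0.
  rewrite /u /M; field; rewrite p0 /=.
  by apply/and3P; split; lra.
have r0 : 0 < (1 - u) / (1 + u) by rewrite divr_gt0//; lra.
split; first by rewrite e mulr_gt0.
have lnr : ln ((1 - u) / (1 + u)) = ln (1 - u) - ln (1 + u).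
  by rewrite ln_div// posrE; lra.
rewrite e lnM ?posrE// lnr.
have l1 : `|ln (1 + u) - u| <= 2 * u ^+ 2.
  by apply: ln1D_approx; rewrite ger0_norm//; lra.
have l2 : `|ln (1 - u) + u| <= 2 * u ^+ 2.
  rewrite -{2}[u]opprK -[u ^+ 2]sqrrN; apply: ln1D_approx.
  by rewrite normrN ger0_norm//; lra.
have us : u ^+ 2 <= tau ^+ 2 by rewrite ler_sqr ?nnegrE//; lra.
have key : 2 * j.+1%:R ^+ 2 / M = 2 * j%:R ^+ 2 / M + 2 * u.
  by rewrite /u -natr1; field; lra.
rewrite key.
have -> : 4 * j.+1%:R * tau ^+ 2 = 4 * j%:R * tau ^+ 2 + 4 * tau ^+ 2.
  by rewrite -natr1; ring.
move: IH l1 l2; rewrite !ler_norml => /andP[? ?] /andP[? ?] /andP[? ?].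
by apply/andP; split; lra.
Qed.

Lemma bpmf_log m k : `|2 * k%:R - 2 * m%:R| <= m%:R :> R ->
  0 < bpmf m.*2 k /\
  `|ln (bpmf m.*2 k) - ln (central m)
     + (2 * k%:R - 2 * m%:R) ^+ 2 / (2 * (2 * m%:R + 1))|
    <= 2 * `|2 * k%:R - 2 * m%:R| ^+ 3 / (2 * m%:R + 1) ^+ 2.
Proof.
move=> km.
wlog mk : k km / (m <= k)%N => [H|].
  have [mk|/ltnW lt] := leqP m k; first exact: H.
  have e : 2 * (m.*2 - k)%:R - 2 * m%:R = - (2 * k%:R - 2 * m%:R) :> R.
    by rewrite natrB -?mul2n ?natrM; [ring|lia].
  have := H (m.*2 - k)%N; rewrite e normrN sqrrN /bpmf bin_sub; last lia.
  by apply => //; lia.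
have [j kE] : exists j, k = (m + j)%N by exists (k - m)%N; rewrite subnKC.
rewrite {k mk}kE in km *.
have e : 2 * (m + j)%:R - 2 * m%:R = 2 * j%:R :> R by rewrite natrD; ring.
have Jm : (4 * j <= 2 * m)%N.
  move: km; rewrite e ger0_norm ?mulr_ge0// -(ler_nat R) !natrM => km; lra.
have [b0 H] := @bpmf_log_right m j j (leqnn j) Jm; split => //.
have m0 : 0 <= m%:R :> R by [].
rewrite e [`|2 * _|]ger0_norm ?mulr_ge0//.
move: H; congr (`|_ + _| <= _); by field; lra.
Qed.

End Binomial.

(** * Frequencies against a binomial reference *)

Section LocalLimit.
Context {R : realType}.

Lemma bpmf_le1 l k : bpmf l k <= 1 :> R.
Proof.
rewrite ler_pdivrMr ?exprn_gt0// mul1r -natrX ler_nat.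
elim: l k => [|l IH] [|k]; rewrite ?bin0 ?expn_gt0//.
by rewrite binS expnS mul2n -addnn leq_add.
Qed.

(** The right-hand side is of first order in [rho] and grows slower than
[2 ^ d] when [rho <= 1 / 2]. *)
Lemma expr_sub1_le (rho : R) d : 0 <= rho ->
  (1 + rho) ^+ d - 1 <= d%:R * rho * (1 + rho) ^+ d.
Proof.
move=> rho0; elim: d => [|d IH]; first by rewrite expr0 !mul0r subrr.
have g0 : 0 <= (1 + rho) ^+ d by rewrite exprn_ge0// addr_ge0.
have d0 : 0 <= d%:R :> R by [].
rewrite exprS -natr1; have := mulr_ge0 rho0 g0.
have := mulr_ge0 (mulr_ge0 d0 rho0) (mulr_ge0 rho0 g0).
have := mulr_ge0 rho0 (mulr_ge0 rho0 g0).
lra.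
Qed.

(** The constants are chosen so that [rho <= 1 / 2] in [bpmf_near]: the
resulting growth [(3 / 2) ^ d] is beaten by the weight [2 ^ - d] of a block
of depth [d]. *)
Lemma bpmf_near_block l d k c : (c <= d)%N -> (4 * d <= l)%N -> (0 < l)%N ->
  (d <= k)%N -> `|2 * k%:R - l%:R| <= l%:R / 8 :> R ->
  `|bpmf (l - d) (k - c) - bpmf l k| <=
    4 / 3 * (`|2 * k%:R - l%:R| + 1) / l%:R *
    (d%:R * (d%:R + 1) * (3 / 2) ^+ d) * bpmf l k :> R.
Proof.
move=> cd dl l0 dk Tl; pose T : R := `|2 * k%:R - l%:R|.
rewrite -/T in Tl *.
have T0 : 0 <= T by exact: normr_ge0.
have l0R : 0 < l%:R :> R by rewrite ltr0n.
have d0 : 0 <= d%:R :> R by [].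
have dlR : 4 * d%:R <= l%:R :> R by rewrite -natrM ler_nat.
have ld0 : 0 < l%:R - d%:R :> R by lra.
pose rho : R := (T + d%:R) / (l%:R - d%:R).
have rho0 : 0 <= rho by rewrite divr_ge0 ?(ltW ld0)// addr_ge0.
have rho12 : rho <= 2^-1 by rewrite ler_pdivrMr//; lra.
have rhoK : rho <= 4 / 3 * (T + 1) / l%:R * (d%:R + 1).
  rewrite ler_pdivrMr//.
  have -> : 4 / 3 * (T + 1) / l%:R * (d%:R + 1) * (l%:R - d%:R) =
    4 / 3 * (T + 1) * (d%:R + 1) * ((l%:R - d%:R) / l%:R) by ring.
  have : 3 / 4 <= (l%:R - d%:R) / l%:R :> R by rewrite ler_pdivlMr//; lra.
  have : 0 <= T * d%:R :> R by rewrite mulr_ge0.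
  move: (_ / l%:R) => w Td w34.
  have : 4 / 3 * (T + 1) * (d%:R + 1) * (3 / 4) <= 4 / 3 * (T + 1) * (d%:R + 1) * w.
    by rewrite ler_wpM2l// !mulr_ge0// ?addr_ge0//; lra.
  lra.
have cl : (c <= k)%N by exact: leq_trans dk.
have dl' : (d < l)%N by lia.
have Hrho : `|2 * k%:R - l%:R| + d%:R <= rho * (l%:R - d%:R).
  by rewrite -/T /rho mulfVK// gt_eqF.
apply: (le_trans (bpmf_near rho l d k c rho0 cd cl dl' Hrho)).
rewrite ler_wpM2r ?bpmf_ge0// (le_trans (expr_sub1_le rho d rho0))//.
have p1 : (1 + rho) ^+ d <= (3 / 2) ^+ d.
  by rewrite lerXn2r ?nnegrE//; lra.
have p0 : 0 <= (1 + rho) ^+ d by rewrite exprn_ge0// addr_ge0.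
rewrite -[leRHS](_ : d%:R * (4 / 3 * (T + 1) / l%:R * (d%:R + 1)) * (3 / 2) ^+ d = _); last by ring.
by apply: ler_pM => //; [rewrite mulr_ge0|apply: ler_wpM2l].
Qed.

Definition occurrences (m : nat -> nat) k n : R := \sum_(0 <= j < n) (m j == k)%:R.

(** Blocks of depth above [D] are bounded trivially, which leaves the term
[2 ^ (l - D)]; the others are summed by [prefix_bound]. *)
Lemma occurrences_near m n l k D (K : R) : splits m -> m 0%N = 0%N ->
  (n <= 2 ^ l)%N -> (D < l)%N -> (D <= k)%N -> 0 <= K ->
  (forall c d, (c <= d)%N -> (d <= D)%N ->
     `|bpmf (l - d) (k - c) - bpmf l k| <=
       K * (d%:R * (d%:R + 1) * (3 / 2) ^+ d) * bpmf l k) ->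
  `|occurrences m k n - n%:R * bpmf l k| <= 2 ^+ (l - D) + 96 * K * 2 ^+ l * bpmf l k.
Proof.
move=> sm m0 nl Dl Dk K0 HK; set b := bpmf l k.
have b0 : 0 <= b by exact: bpmf_ge0.
have b1 : b <= 1 by exact: bpmf_le1.
pose f i : R := (i == k)%:R - b.
have f1 i : `|f i| <= 1.
  by rewrite /f ler_norml; case: (i == k) => /=; apply/andP; split; lra.
have -> : occurrences m k n - n%:R * b = prefix f m l 0 n.
  rewrite /prefix /f /occurrences sumrB sumr_const_nat subn0 mulr_natl.
  by congr (_ - _); apply: eq_bigr => i _; rewrite mul0n add0n.
(* [F d] is the sum of [i (i + 1) (3 / 4) ^ i] over [i > d]. *)
pose F (d : nat) : R := (4 * (d%:R + 1) ^+ 2 + 28 * (d%:R + 1) + 96) * (3 / 4) ^+ d.+1.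
have F0 d : 0 <= F d.
  by rewrite mulr_ge0 ?exprn_ge0// !addr_ge0// ?mulr_ge0 ?exprn_ge0 ?addr_ge0.
pose H L : R := 2 ^+ (l - D) + b * K * 2 ^+ l * F (l - L)%N.
have -> : 2 ^+ (l - D) + 96 * K * 2 ^+ l * b = H l.
  by rewrite /H subnn /F expr1; field.
have l2 : 0 < 2 ^+ l :> R by rewrite exprn_gt0.
apply: (@prefix_bound R f m l (l - D)%N H sm) => //; rewrite ?m0 ?leq_subr ?leqnn//.
- move=> q r _ rD; rewrite (@le_trans _ _ r%:R)//.
    rewrite (le_trans (ler_norm_sum _ _ _))//.
    rewrite (@le_trans _ _ (\sum_(0 <= i < r) 1))//; first exact: ler_sum.
    by rewrite sumr_const_nat subn0.
  rewrite (@le_trans _ _ (2 ^+ (l - D)))//; first by rewrite -natrX ler_nat.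
  by rewrite lerDl !mulr_ge0// ltW.
- move=> L c /andP[L0L Ll] cL.
  have [d dE] : exists d, (l - L = d.+1)%N by exists (l - L).-1; lia.
  have dE' : (l - L.+1 = d)%N by lia.
  have LE : (L = l - d.+1)%N by lia.
  have dD : (d.+1 <= D)%N by lia.
  have lE : (l = L + d.+1)%N by lia.
  rewrite /H dE dE'.
  have ck : (c <= k)%N by lia.
  have wE : walk f L c = 2 ^+ L * (bpmf L (k - c) - b).
    rewrite (@walk_shift _ f (fun i => (i == k)%:R) (- b))// walk_delta//.
    rewrite mulrBr mulrN; congr (_ - _).
    by rewrite [RHS]mulrC divfK// expf_neq0.
  have cd : (c <= d.+1)%N by rewrite -dE.
  have := HK c d.+1 cd dD; rewrite -LE -/b => Hb.
  rewrite wE normrM [`|2 ^+ L|]ger0_norm ?exprn_ge0//.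
  have e2 : 2 ^+ L * (3 / 2) ^+ d.+1 = 2 ^+ l * (3 / 4) ^+ d.+1 :> R.
    rewrite lE exprD -mulrA -exprMn; congr (_ * _ ^+ _); by field.
  have := ler_wpM2l (exprn_ge0 L (ler0n R 2)) Hb.
  have -> : 2 ^+ L * (K * (d.+1%:R * (d.+1%:R + 1) * (3 / 2) ^+ d.+1) * b) =
    b * K * 2 ^+ l * (d.+1%:R * (d.+1%:R + 1) * (3 / 4) ^+ d.+1).
    rewrite -[RHS](_ : b * K * (d.+1%:R * (d.+1%:R + 1)) * (2 ^+ l * (3 / 4) ^+ d.+1) = _); last by ring.
    by rewrite -e2; ring.
  have -> : d.+1%:R * (d.+1%:R + 1) * (3 / 4) ^+ d.+1 = F d - F d.+1.
    by rewrite /F [_ ^+ d.+2]exprS -natr1; by field.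
  rewrite mulrBr; lra.
Qed.

End LocalLimit.

(** * Gaussian error estimates *)

Section GaussianEstimates.
Context {R : realType}.

(** Here and below [s] stands for the square root of [L], [x] for the
standardized variable and [t] for [2 k] minus the number of steps; the
hypothesis on [t] absorbs all roundings. *)
Lemma deviation_bound (s x t : R) : 32 < s -> `|x| ^+ 3 <= s -> `|t - x * s| <= 4 ->
  [/\ `|t| <= `|x| * s + 4, `|x| * s <= s ^+ 2 / 10 & x ^+ 2 <= s ^+ 2 / 100].
Proof.
move=> s31 y3 ht; have y0 : 0 <= `|x| by [].
have ys : `|x| <= s / 10.
  rewrite leNgt; apply/negP => ys.
  have : (s / 10) ^+ 3 <= `|x| ^+ 3 by rewrite lerXn2r ?nnegrE; lra.
  have : 0 < s * (s - 32) * (s + 32) by rewrite !mulr_gt0; lra.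
  rewrite !exprS !expr0; nra.
split.
- rewrite -[t](subrK (x * s)) (le_trans (ler_normD _ _))// normrM.
  by rewrite (ger0_norm (_ : 0 <= s)); lra.
- by nra.
- by rewrite -real_normK ?num_real//; nra.
Qed.

Lemma gauss_exponent_error (s x t M : R) : 32 < s -> `|x| ^+ 3 <= s ->
  s ^+ 2 + 1 <= 2 * M <= s ^+ 2 + 2 -> `|t - x * s| <= 4 ->
  `|t ^+ 2 / (2 * (2 * M + 1)) - x ^+ 2 / 2| <= 14 * ((1 + `|x| ^+ 3) / s).
Proof.
move=> s31 y3 /andP[M1 M2] ht; have y0 : 0 <= `|x| by [].
have [tb _ _] := deviation_bound _ _ _ s31 y3 ht.
pose y : R := `|x|; rewrite -/y in y0 y3 tb *.
have xy : x ^+ 2 = y ^+ 2 by rewrite /y real_normK ?num_real.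
have M0 : 0 < 2 * M + 1 by nra.
have -> : t ^+ 2 / (2 * (2 * M + 1)) - x ^+ 2 / 2 =
   ((t - x * s) * (t + x * s) - x ^+ 2 * (2 * M + 1 - s ^+ 2)) / (2 * (2 * M + 1)).
  by field; lra.
have D0 : 0 < 2 * (2 * M + 1) by rewrite mulr_gt0.
rewrite normrM [`|_^-1|]ger0_norm ?invr_ge0 ?(ltW D0)// ler_pdivrMr//.
have h1 : `|(t - x * s) * (t + x * s) - x ^+ 2 * (2 * M + 1 - s ^+ 2)| <=
   4 * (2 * y * s + 4) + 3 * y ^+ 2.
  rewrite xy (le_trans (ler_normB _ _))// normrM [`|y ^+ 2 * _|]normrM.
  have a1 : `|t + x * s| <= 2 * y * s + 4.
    rewrite (le_trans (ler_normD _ _))// normrM (ger0_norm (_ : 0 <= s)) -/y; lra.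
  rewrite lerD//; first by apply: ler_pM.
  rewrite [`|y ^+ 2|]ger0_norm ?sqr_ge0// mulrC ler_wpM2r ?sqr_ge0//.
  by rewrite ger0_norm; lra.
apply: (le_trans h1).
have -> : 14 * ((1 + y ^+ 3) / s) * (2 * (2 * M + 1)) =
   (28 * (1 + y ^+ 3)) * ((2 * M + 1) / s) by field; lra.
have h2 : s <= (2 * M + 1) / s by rewrite ler_pdivlMr; nra.
have y30 : 0 <= y ^+ 3 by rewrite exprn_ge0.
apply: (@le_trans _ _ (28 * (1 + y ^+ 3) * s)); last by rewrite ler_wpM2l//; lra.
have h3 : y <= 1 + y ^+ 3.
  have := mulr_ge0 y0 (sqr_ge0 (y - 1)); rewrite !exprS !expr0; nra.
have h4 : y ^+ 2 <= 1 + y ^+ 3.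
  have := mulr_ge0 y0 (sqr_ge0 (y - 1)); have := sqr_ge0 (y - 1).
  rewrite !exprS !expr0; nra.
move: (y ^+ 3) (y ^+ 2) h3 h4 y30 => c q h3 h4 y30.
have : y * s <= (1 + c) * s by rewrite ler_wpM2r//; lra.
have : 31 * (1 + c) <= (1 + c) * s by rewrite mulrC ler_wpM2l//; lra.
lra.
Qed.

Lemma cubic_error (s x t M : R) : 32 < s -> `|x| ^+ 3 <= s ->
  s ^+ 2 + 1 <= 2 * M <= s ^+ 2 + 2 -> `|t - x * s| <= 4 ->
  2 * `|t| ^+ 3 / (2 * M + 1) ^+ 2 <= 8 * ((1 + `|x| ^+ 3) / s).
Proof.
move=> s31 y3 /andP[M1 M2] ht; have y0 : 0 <= `|x| by [].
have [tb _ _] := deviation_bound _ _ _ s31 y3 ht.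
pose y : R := `|x|; rewrite -/y in y0 y3 tb *.
have s0 : 0 < s by lra.
have M0 : 0 < (2 * M + 1) ^+ 2 by rewrite exprn_gt0//; nra.
rewrite ler_pdivrMr//.
have h1 : `|t| ^+ 3 <= ((y + 1) * s) ^+ 3.
  by rewrite lerXn2r ?nnegrE ?mulr_ge0//; lra.
have h2 : (y + 1) ^+ 3 <= 4 * (1 + y ^+ 3).
  have : 0 <= (y + 1) * (y - 1) ^+ 2 by rewrite mulr_ge0 ?sqr_ge0//; lra.
  by rewrite !exprS !expr0; lra.
have h3 : s ^+ 4 <= (2 * M + 1) ^+ 2.
  by have := sqr_ge0 s; rewrite (exprM s 2 2) => s2; rewrite lerXn2r ?nnegrE//; lra.
have s3 : 0 <= s ^+ 3 by rewrite exprn_ge0// ltW.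
have h4 : ((y + 1) * s) ^+ 3 <= 4 * (1 + y ^+ 3) * s ^+ 3.
  by rewrite exprMn ler_wpM2r.
have y30 : 0 <= y ^+ 3 by rewrite exprn_ge0.
have : 8 * ((1 + y ^+ 3) / s) * s ^+ 4 <= 8 * ((1 + y ^+ 3) / s) * (2 * M + 1) ^+ 2.
  by rewrite ler_wpM2l// mulr_ge0// divr_ge0 ?ltW//; lra.
have -> : 8 * ((1 + y ^+ 3) / s) * s ^+ 4 = 8 * (1 + y ^+ 3) * s ^+ 3.
  by field; lra.
lra.
Qed.

Lemma width_error (s x t M : R) : 32 < s -> `|x| ^+ 3 <= s ->
  s ^+ 2 + 1 <= 2 * M -> `|t - x * s| <= 4 ->
  4 / 3 * (`|t| + 1) / (2 * M) <= 8 * ((1 + `|x| ^+ 3) / s).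
Proof.
move=> s31 y3 M1 ht; have y0 : 0 <= `|x| by [].
have [tb _ _] := deviation_bound _ _ _ s31 y3 ht.
pose y : R := `|x|; rewrite -/y in y0 y3 tb *.
have s0 : 0 < s by lra.
rewrite ler_pdivrMr; last by nra.
have y30 : 0 <= y ^+ 3 by rewrite exprn_ge0.
have h3 : y <= 1 + y ^+ 3.
  have := mulr_ge0 y0 (sqr_ge0 (y - 1)); rewrite !exprS !expr0; nra.
have : 8 * ((1 + y ^+ 3) / s) * s ^+ 2 <= 8 * ((1 + y ^+ 3) / s) * (2 * M).
  by rewrite ler_wpM2l//; [rewrite mulr_ge0// divr_ge0 ?ltW|]; lra.
have -> : 8 * ((1 + y ^+ 3) / s) * s ^+ 2 = 8 * (1 + y ^+ 3) * s by field; lra.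
move: (y ^+ 3) h3 y30 => c h3 y30.
have : y * s <= (1 + c) * s by rewrite ler_wpM2r//; lra.
have : 31 * (1 + c) <= (1 + c) * s by rewrite mulrC ler_wpM2l//; lra.
lra.
Qed.

(** In the range considered the Gaussian factor is at least
[exp (- s ^ 2 / 200)], so the blocks cut off at depth [D], about [L / 4], are
negligible against it even after division by [s ^ 2]. *)
Lemma tail_error (L D : nat) (s : R) : s ^+ 2 = L%:R -> (L <= 4 * D + 1)%N ->
  s ^+ 2 * expR (s ^+ 2 / 200) <= 10 * expR 1 * 2 ^+ D.
Proof.
move=> sL LD.
have LDR : L%:R <= 4 * D%:R + 1 :> R by rewrite -natrM natr1 ler_nat -addn1.
have h2 : expR (D%:R / 2) <= 2 ^+ D :> R.
  rewrite mulrC expRM_natr lerXn2r ?nnegrE ?expR_ge0//.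
  have := ler_wpM2l (expR_ge0 (2^-1 : R)) (expR_ge1Dx (- 2^-1 : R)).
  rewrite expRxMexpNx_1; lra.
apply: (@le_trans _ _ (10 * expR 1 * expR (D%:R / 2))); last first.
  by rewrite ler_wpM2l// mulr_ge0// expR_ge0.
have h3 : s ^+ 2 / 10 <= expR (s ^+ 2 / 10) by have := expR_ge1Dx (s ^+ 2 / 10); lra.
apply: (@le_trans _ _ (10 * (expR (s ^+ 2 / 10) * expR (s ^+ 2 / 200)))).
  rewrite mulrA ler_wpM2r ?expR_ge0//; lra.
rewrite -mulrA -!expRD ler_wpM2l// ler_expR sL.
have : 0 <= L%:R :> R by [].
lra.
Qed.

Lemma expR_sub1_norm (u B : R) : `|u| <= B -> `|expR u - 1| <= `|u| * expR B.
Proof.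
move=> uB; have B0 : 0 <= B by apply: le_trans uB.
have eB : 1 <= expR B by rewrite -[leLHS]expR0 ler_expR.
have [u0|u0] := leP 0 u.
  rewrite ger0_norm in uB *; last by [].
  rewrite ger0_norm ?subr_ge0 -?[leLHS]expR0 ?ler_expR//.
  have : expR u * (1 - u) <= 1.
    have := ler_wpM2l (expR_ge0 u) (expR_ge1Dx (- u)).
    by rewrite expRxMexpNx_1.
  have : u * expR u <= u * expR B by rewrite ler_wpM2l// ler_expR.
  lra.
rewrite ltr0_norm in uB *; last by [].
rewrite ler0_norm; last by rewrite subr_le0 -[leRHS]expR0 ler_expR ltW.
have := expR_ge1Dx u.
have : - u * 1 <= - u * expR B by rewrite ler_wpM2l//; lra.
lra.
Qed.

End GaussianEstimates.

(** * The local limit formula up to a constant *)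

Section LocalLimitTheorem.
Context {R : realType}.

(** The reference walk has an even number [M.*2] of steps, so that it has a
centre, and more than [L] steps, so that [0, n) fits into one block. *)
Lemma half_bounds (L : nat) (M := (L./2).+1) (D := M./2) :
  [/\ (L.+1 <= M.*2)%N, (M.*2 <= L + 2)%N, (L <= 4 * D + 1)%N & (2 * D <= M)%N].
Proof.
have := odd_double_half L; have := odd_double_half M; rewrite -/D /M.
move: (L./2) D => h D; move: (odd L) (odd h.+1) => [] []; split; lia.
Qed.

Lemma error_scale (s x : R) (E : R := (1 + `|x| ^+ 3) / s) :
  32 < s -> `|x| ^+ 3 <= s ->
  [/\ 0 < E, s^-1 <= E, E <= 2 & (s ^+ 2)^-1 <= E].
Proof.
rewrite /E => s32 x3; have x30 : 0 <= `|x| ^+ 3 by rewrite exprn_ge0.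
have s0 : 0 < s by lra.
have E0 : 0 < (1 + `|x| ^+ 3) / s by rewrite divr_gt0//; lra.
have sE : s^-1 <= (1 + `|x| ^+ 3) / s by rewrite ler_pdivlMr// mulVf; lra.
split => //; first by rewrite ler_pdivrMr//; lra.
apply: le_trans sE; rewrite lef_pV2 ?posrE ?exprn_gt0// expr2.
by rewrite ler_peMl; lra.
Qed.

Lemma ln_half_error (v M : R) : 0 < v -> v + 1 <= 2 * M <= v + 2 ->
  `|ln M - ln (v / 2)| <= 2 * v^-1.
Proof.
move=> v0 /andP[M1 M2].
have M0 : 0 < M by lra.
have v20 : 0 < v / 2 by lra.
rewrite -ln_div ?posrE// ger0_norm; last first.
  by apply: ln_ge0; rewrite ler_pdivlMr//; lra.
have -> : M / (v / 2) = 1 + (2 * M - v) / v by field; lra.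
have h : 0 <= (2 * M - v) / v by rewrite divr_ge0//; lra.
rewrite (le_trans (le_ln1Dx _))//; first by lra.
by rewrite ler_wpM2r ?invr_ge0; lra.
Qed.

Lemma ln_gauss (kappa s x : R) : 0 < kappa -> 0 < s ->
  ln (Num.sqrt (2 * kappa) * expR (- x ^+ 2 / 2) / s) =
  (ln kappa - ln (s ^+ 2 / 2)) / 2 - x ^+ 2 / 2.
Proof.
move=> k0 s0; have A0 : 0 < Num.sqrt (2 * kappa) by rewrite sqrtr_gt0 mulr_gt0.
rewrite mulrAC.
have As : 0 < Num.sqrt (2 * kappa) / s by rewrite divr_gt0.
rewrite [LHS]lnM ?posrE ?expR_gt0// expRK mulNr; congr (_ - _).
have : ln ((Num.sqrt (2 * kappa) / s) ^+ 2) = ln kappa - ln (s ^+ 2 / 2).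
  rewrite -ln_div ?posrE ?divr_gt0 ?exprn_gt0//; congr ln.
  rewrite expr_div_n sqr_sqrtr; last by rewrite mulr_ge0 ?ltW.
  by field; lra.
by rewrite lnXn// mulr2n; lra.
Qed.

(** Sums the errors of four replacements: the logarithm of the ratio to the
central term, the Gaussian exponent, the central term, and [M] by [L / 2]. *)
Lemma bpmf_gauss (kappa s x : R) (M k : nat) (E : R := (1 + `|x| ^+ 3) / s) :
  0 < kappa -> 32 < s -> `|x| ^+ 3 <= s ->
  s ^+ 2 + 1 <= 2 * M%:R <= s ^+ 2 + 2 ->
  `|2 * k%:R - 2 * M%:R - x * s| <= 4 ->
  `|ln (central M : R) - (ln kappa - ln M%:R) / 2| <= (2 * M%:R)^-1 ->
  0 < bpmf M.*2 k :> R /\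
  `|ln (bpmf M.*2 k) - ln (Num.sqrt (2 * kappa) * expR (- x ^+ 2 / 2) / s)|
    <= 24 * E.
Proof.
move=> k0 s32 x3 M12 tx log3.
have s0 : 0 < s by lra.
have [E0 sE E2 ssE] := error_scale _ _ s32 x3; rewrite -/E in E0 sE E2 ssE.
have [tb xs _] := deviation_bound _ _ _ s32 x3 tx.
have s21024 : 1024 < s ^+ 2 by rewrite expr2; clear -s32; nra.
have kM : `|2 * k%:R - 2 * M%:R| <= M%:R :> R.
  by case/andP: M12 => M1 _; lra.
have [b0 blog] := @bpmf_log R M k kM.
split => //.
have log1 := le_trans blog (cubic_error _ _ _ _ s32 x3 M12 tx).
have log2 := gauss_exponent_error _ _ _ _ s32 x3 M12 tx.
have log4 := ln_half_error (s ^+ 2) _ (lt_trans (ltr0n R 1024) s21024) M12.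
have log5 : (2 * M%:R)^-1 <= E.
  apply: le_trans ssE; move/andP: M12 => [M1 _].
  by rewrite lef_pV2 ?posrE; clear -M1 s21024; lra.
rewrite ln_gauss//.
have {}log4 := le_trans log4 (ler_wpM2l (ler0n _ 2) ssE).
have {}log3 := le_trans log3 log5.
move: log1 log2 log3 log4; rewrite -/E.
move: (ln (bpmf _ _)) (ln (central _)) (_ ^+ 2 / (_ * _)) (ln kappa) (ln M%:R).
move: (x ^+ 2 / 2) (ln (s ^+ 2 / 2)) => X lv lb la T lk lM; clear.
rewrite !ler_norml => /andP[? ?] /andP[? ?] /andP[? ?] /andP[? ?].
by apply/andP; split; lra.
Qed.

Lemma expR_close (b G B d : R) : 0 < b -> 0 < G -> `|ln b - ln G| <= d -> d <= B ->
  b <= G * expR B /\ `|b - G| <= d * expR B * G.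
Proof.
move=> b0 G0 lnb dB; have lnB := le_trans lnb dB.
have bG : b = G * expR (ln b - ln G).
  by rewrite expRB !lnK ?posrE// mulrC divfK// gt_eqF.
split; first by rewrite bG ler_pM2l// ler_expR (le_trans (ler_norm _)).
have -> : b - G = G * (expR (ln b - ln G) - 1) by rewrite mulrBr mulr1 -bG.
rewrite normrM (gtr0_norm G0) mulrC ler_pM2r//.
by rewrite (le_trans (expR_sub1_norm _ _ lnB))// ler_wpM2r ?expR_ge0.
Qed.

Lemma tail_negligible (A s x : R) (L D : nat) : 0 < A -> 0 < s -> s ^+ 2 = L%:R ->
  (L <= 4 * D + 1)%N -> x ^+ 2 <= s ^+ 2 / 100 ->
  4 / 2 ^+ D <= 40 * (expR 1 / A) * s^-1 * (A * expR (- x ^+ 2 / 2) / s).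
Proof.
move=> A0 s0 s2 LD x2; have h := @tail_error R L D s s2 LD.
have D0 : 0 < 2 ^+ D :> R by rewrite exprn_gt0.
have eG : A * expR (- (s ^+ 2 / 200)) / s <= A * expR (- x ^+ 2 / 2) / s.
  by rewrite ler_pM2r ?invr_gt0// ler_pM2l// ler_expR; lra.
have e0 := expR_gt0 (s ^+ 2 / 200).
apply: (@le_trans _ _ (40 * (expR 1 / A) * s^-1 * (A * expR (- (s ^+ 2 / 200)) / s))).
  rewrite expRN ler_pdivrMr//.
  have -> : 40 * (expR 1 / A) / s * (A * (expR (s ^+ 2 / 200))^-1 / s) * 2 ^+ D =
    4 * (10 * expR 1 * 2 ^+ D) / (s ^+ 2 * expR (s ^+ 2 / 200)).
    by field; rewrite !gt_eqF.
  by rewrite ler_pdivlMr ?mulr_gt0 ?exprn_gt0//; lra.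
apply: ler_wpM2l => //.
by rewrite mulr_ge0 ?invr_ge0 ?(ltW s0)// mulr_ge0// divr_ge0 ?expR_ge0 ?ltW.
Qed.

Lemma occurrences_near_bpmf m (n L k : nat) (s x : R) (M := (L./2).+1) (D := M./2)
    (E : R := (1 + `|x| ^+ 3) / s) (b : R := bpmf M.*2 k) :
  splits m -> m 0%N = 0%N -> (2 ^ L <= n <= 2 ^ L.+1)%N ->
  s ^+ 2 = L%:R -> 32 < s -> `|x| ^+ 3 <= s ->
  `|2 * k%:R - 2 * M%:R - x * s| <= 4 ->
  `|occurrences m k n / n%:R - b| <= 4 / 2 ^+ D + 3072 * E * b.
Proof.
move=> sm m0 /andP[Ln nL] s2 s32 x3 tx.
have [M1n M2n LD DM] := half_bounds L; rewrite -/M -/D in M1n M2n LD DM.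
have s0 : 0 < s by lra.
have lE : M.*2%:R = 2 * M%:R :> R by rewrite -mul2n natrM.
have M1 : s ^+ 2 + 1 <= 2 * M%:R by rewrite -lE s2 natr1 ler_nat.
have [tb xs _] := deviation_bound _ _ _ s32 x3 tx.
have s21024 : 1024 < s ^+ 2 by rewrite expr2; clear -s32; nra.
have b0 : 0 <= b by exact: bpmf_ge0.
have n0 : 0 < n%:R :> R by rewrite ltr0n (leq_trans _ Ln)// expn_gt0.
have l4n : 2 ^+ M.*2 <= 4 * n%:R :> R.
  rewrite -natrX -natrM ler_nat (@leq_trans (2 ^ (L + 2)))//.
    by rewrite leq_exp2l.
  by rewrite expnD mulnC leq_mul2l.
have Dl : (D < M.*2)%N by clear -DM; rewrite /M in DM *; lia.
have Dk : (D <= k)%N.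
  have DMR : 2 * D%:R <= M%:R :> R by rewrite -natrM ler_nat.
  rewrite -(ler_nat R); have := ler_norm (- (2 * k%:R - 2 * M%:R) : R).
  rewrite normrN => nt; clear -DMR tb xs s21024 M1 nt; lra.
pose T : R := `|2 * k%:R - 2 * M%:R|.
have TM : T <= M.*2%:R / 8 by rewrite lE; clear -tb xs s21024 M1; rewrite /T; lra.
pose K : R := 4 / 3 * (T + 1) / (2 * M%:R).
have T0 : 0 <= T by exact: normr_ge0.
have KE : K <= 8 * E by exact: width_error.
have K0 : 0 <= K by rewrite /K divr_ge0 ?mulr_ge0 ?divr_ge0 ?addr_ge0.
have nl : (n <= 2 ^ M.*2)%N by rewrite (leq_trans nL)// leq_exp2l.
have D0 : 0 < 2 ^+ D :> R by rewrite exprn_gt0.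
have near : `|occurrences m k n - n%:R * b| <= 2 ^+ (M.*2 - D) + 96 * K * 2 ^+ M.*2 * b.
  apply: occurrences_near => // c d cd dD.
  have dl4 : (4 * d <= M.*2)%N by clear -DM dD; rewrite /M in DM *; lia.
  have := @bpmf_near_block R M.*2 d k c cd dl4 isT (leq_trans dD Dk).
  by rewrite lE -/T -/K -/b -lE; apply.
clearbody K.
have -> : occurrences m k n / n%:R - b = (occurrences m k n - n%:R * b) / n%:R.
  by field; rewrite gt_eqF.
rewrite normrM [`|n%:R^-1|]gtr0_norm ?invr_gt0// ler_pdivrMr//.
apply: (le_trans near).
have -> : 2 ^+ (M.*2 - D) = 2 ^+ M.*2 / 2 ^+ D :> R.
  by rewrite -[in RHS](subnK (ltnW Dl)) exprD mulfK// gt_eqF.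
have h1 : 2 ^+ M.*2 / 2 ^+ D <= 4 * n%:R / 2 ^+ D :> R by rewrite ler_pM2r ?invr_gt0.
have h2 : 96 * K * b * 2 ^+ M.*2 <= 96 * K * b * (4 * n%:R).
  by rewrite ler_wpM2l// !mulr_ge0.
have h3 : K * (b * n%:R) <= 8 * E * (b * n%:R).
  by rewrite ler_wpM2r// mulr_ge0// ltW.
by clear -h1 h2 h3; clearbody b E; lra.
Qed.

(** The constant [A] is determined only later, by normalization.  Any [k] within
distance 1 is allowed, which covers both rounding down and the exact
standardization of an integer. *)
Definition local_limit_law (m : nat -> nat) (A C : R) :=
  forall (L n k : nat) (x : R),
    (2 ^ L <= n <= 2 ^ L.+1)%N -> 32 < Num.sqrt (L%:R : R) ->
    `|x| ^+ 3 <= Num.sqrt L%:R ->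
    `|L%:R / 2 + x * Num.sqrt L%:R / 2 - k%:R| <= 1 ->
  exists2 r : R, `|r| <= C * ((1 + `|x| ^+ 3) / Num.sqrt L%:R) &
    occurrences m k n / n%:R = A * expR (- x ^+ 2 / 2) / Num.sqrt L%:R * (1 + r).

Theorem local_limit_up_to_constant : exists A C : R, [/\ 0 < A, 0 < C &
  forall m : nat -> nat, splits m -> m 0%N = 0%N -> local_limit_law m A C].
Proof.
have [kappa kappa0 central_kappa] := @central_asymp R.
pose A := Num.sqrt (2 * kappa).
have A0 : 0 < A by rewrite sqrtr_gt0 mulr_gt0.
have cA : 0 < expR 1 / A by rewrite divr_gt0 ?expR_gt0.
have e48 := expR_gt0 (48 : R).
have C0 : 0 < 40 * (expR 1 / A) + 3096 * expR 48 by clear -cA e48; lra.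
exists A, (40 * (expR 1 / A) + 3096 * expR 48).
split => // m sm m0 L n k x Ln.
have : Num.sqrt L%:R ^+ 2 = L%:R :> R by rewrite sqr_sqrtr.
move: (Num.sqrt L%:R : R) => s s2 s32 x3 xk.
have s0 : 0 < s by clear -s32; lra.
pose M := (L./2).+1; pose D := M./2.
have [M1n M2n LD _] := half_bounds L; rewrite -/M -/D in M1n M2n LD.
have M12 : s ^+ 2 + 1 <= 2 * M%:R <= s ^+ 2 + 2.
  by rewrite s2 natr1 -natrD -natrM !ler_nat mul2n M1n.
have tx : `|2 * k%:R - 2 * M%:R - x * s| <= 4.
  clear -xk M12 s2; case/andP: M12; rewrite s2 => M1 M2; move: xk.
  by rewrite !ler_norml => /andP[? ?]; apply/andP; split; lra.
have [tb xs x2] := deviation_bound _ _ _ s32 x3 tx.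
have [E0 sE E2 ssE] := error_scale _ _ s32 x3.
have [b0 lnb] := bpmf_gauss _ _ _ _ _ kappa0 s32 x3 M12 tx (central_kappa M isT).
have near := occurrences_near_bpmf _ _ _ _ _ _ sm m0 Ln s2 s32 x3 tx.
have tail := tail_negligible A _ _ _ _ A0 s0 s2 LD x2.
rewrite -/M -/D -/A in lnb near tail.
have G0 : 0 < A * expR (- x ^+ 2 / 2) / s by rewrite divr_gt0 ?mulr_gt0 ?expR_gt0.
pose G : R := A * expR (- x ^+ 2 / 2) / s; pose E : R := (1 + `|x| ^+ 3) / s.
rewrite -/G -/E in E0 sE E2 lnb near tail G0 *.
have E48 : 24 * E <= 48 by clear -E2; lra.
have [bG48 bGd] := expR_close _ _ _ _ b0 G0 lnb E48.
exists (occurrences m k n / n%:R / G - 1); last first.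
  by rewrite [1 + _]addrC subrK [RHS]mulrC divfK// gt_eqF.
pose p : R := occurrences m k n / n%:R; pose b : R := bpmf M.*2 k.
rewrite -/p -/b in b0 bG48 bGd near *.
clearbody p b.
have -> : p / G - 1 = (p - G) / G by rewrite mulrBl mulfV// gt_eqF.
rewrite normrM [`|G^-1|]gtr0_norm ?invr_gt0// ler_pdivrMr//.
have -> : p - G = (p - b) + (b - G) by ring.
rewrite (le_trans (ler_normD _ _))//.
have h1 : E * b <= E * (G * expR 48) by rewrite ler_wpM2l// ltW.
have h2 : expR 1 / A * s^-1 * G <= expR 1 / A * E * G.
  by rewrite ler_wpM2r ?(ltW G0)// ler_wpM2l// ltW.
clear -h1 h2 near bGd tail; clearbody G E A; lra.
Qed.

End LocalLimitTheorem.

(** * First and second moments *)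

Section Moments.
Context {R : realType}.

Lemma sum_eq_prefix (f : nat -> R) m l n :
  \sum_(0 <= j < n) f (m j) = prefix f m l 0 n.
Proof. by apply: eq_bigr => i _; rewrite mul0n add0n. Qed.

Lemma prefix_bound1 (f : nat -> R) m q r (B : R) : 0 <= B -> `|f (m q)| <= B ->
  (r <= 2 ^ 0)%N -> `|prefix f m 0 q r| <= B.
Proof.
move=> B0 fB; case: r => [|[|//]] _; first by rewrite /prefix big_geq// normr0.
by rewrite /prefix big_nat1 muln1 addn0.
Qed.

(** A block of depth [d] has mean [c + (l - d) / 2] with [0 <= c <= d], which
is within [d / 2] of [l / 2]. *)
Lemma mean_deviation m n l : splits m -> m 0%N = 0%N -> (n <= 2 ^ l)%N ->
  `|\sum_(0 <= j < n) ((m j)%:R - l%:R / 2)| <= 2 ^+ l :> R.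
Proof.
move=> sm m0 nl; pose f i : R := i%:R - l%:R / 2.
rewrite (sum_eq_prefix f m l).
(* [(d + 2) / 2 ^ (d + 1)] is the sum of [i / 2 ^ (i + 1)] over [i > d]. *)
pose H L : R := 2 ^+ L * ((l - L)%:R + 2) / 2.
have -> : 2 ^+ l = H l by rewrite /H subnn add0r mulfK.
apply: (@prefix_bound R f m l 0 H sm) => //; rewrite ?subn0 ?m0 ?leqnn//.
- move=> q r mq r1; apply: prefix_bound1 => //; rewrite /H ?expr0 ?subn0.
    by rewrite divr_ge0 ?mulr_ge0 ?addr_ge0.
  have mqR : (m q)%:R <= l%:R :> R by rewrite ler_nat.
  have mq0 : 0 <= (m q)%:R :> R by [].
  by rewrite /f ler_norml; clear -mqR mq0; apply/andP; split; lra.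
- move=> L c /andP[_ Ll] cd; rewrite walk_linear /H.
  have [d dE] : exists d, (l - L = d.+1)%N by exists (l - L).-1; lia.
  rewrite dE in cd *; rewrite (_ : (l - L.+1)%N = d); last by lia.
  have -> : c%:R + L%:R / 2 - l%:R / 2 = c%:R - d.+1%:R / 2 :> R.
    by rewrite -dE natrB ?(ltnW Ll)//; field.
  have cdR : c%:R <= d.+1%:R :> R by rewrite ler_nat.
  have c0 : 0 <= c%:R :> R by [].
  have h : `|c%:R - d.+1%:R / 2| <= d.+1%:R / 2 :> R.
    by rewrite ler_norml; clear -cdR c0; apply/andP; split; lra.
  have p0 : 0 <= 2 ^+ L :> R by rewrite exprn_ge0.
  rewrite normrM (ger0_norm p0); have := ler_wpM2l p0 h.
  by rewrite [2 ^+ L.+1]exprS -natr1; clear; lra.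
Qed.

(** A block of depth [d] has second moment [(c - d / 2) ^ 2 + (l - d) / 4]
about [l / 2], which differs from [l / 4] by at most [(d ^ 2 + d) / 4]. *)
Lemma variance_deviation m n l : splits m -> m 0%N = 0%N -> (n <= 2 ^ l)%N ->
  `|\sum_(0 <= j < n) (((m j)%:R - l%:R / 2) ^+ 2 - l%:R / 4)| <= 2 * 2 ^+ l :> R.
Proof.
move=> sm m0 nl; pose f i : R := (i%:R - l%:R / 2) ^+ 2 - l%:R / 4.
rewrite (sum_eq_prefix f m l).
(* [(d ^ 2 + 5 d + 8) / 2 ^ (d + 2)] is the sum of [(i ^ 2 + i) / 2 ^ (i + 2)] over [i > d]. *)
pose H L : R := 2 ^+ L * ((l - L)%:R ^+ 2 + 5 * (l - L)%:R + 8) / 4.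
have -> : 2 * 2 ^+ l = H l by rewrite /H subnn expr0n /=; field.
have dev (c d : nat) : (c <= d)%N ->
    `|(c%:R - d%:R / 2) ^+ 2 - d%:R / 4| <= (d%:R ^+ 2 + d%:R) / 4 :> R.
  move=> cd; have cdR : c%:R <= d%:R :> R by rewrite ler_nat.
  have c0 : 0 <= c%:R :> R by [].
  have := mulr_ge0 c0 (_ : 0 <= d%:R - c%:R); rewrite subr_ge0 => /(_ cdR).
  have := sqr_ge0 (c%:R - d%:R / 2 : R).
  by rewrite ler_norml !expr2; clear -cdR c0 => h1 h2; apply/andP; split; lra.
apply: (@prefix_bound R f m l 0 H sm) => //; rewrite ?subn0 ?m0 ?leqnn//.
- move=> q r mq r1; apply: prefix_bound1 => //; rewrite /H ?expr0 ?subn0.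
    by rewrite divr_ge0 ?mulr_ge0 ?addr_ge0 ?sqr_ge0 ?mulr_ge0.
  rewrite /f (le_trans (dev _ _ mq))//.
  have l0 : 0 <= l%:R :> R by [].
  by clear -l0; lra.
- move=> L c /andP[_ Ll] cd.
  have -> : walk f L c =
      2 ^+ L * ((c%:R + L%:R / 2 - l%:R / 2) ^+ 2 + L%:R / 4 - l%:R / 4).
    rewrite (@walk_shift _ f (fun i => (i%:R - l%:R / 2) ^+ 2) (- (l%:R / 4)))//.
    by rewrite walk_square -mulrDr.
  rewrite /H.
  have [d dE] : exists d, (l - L = d.+1)%N by exists (l - L).-1; lia.
  rewrite dE in cd *; rewrite (_ : (l - L.+1)%N = d); last by lia.
  have -> : (c%:R + L%:R / 2 - l%:R / 2) ^+ 2 + L%:R / 4 - l%:R / 4 =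
            (c%:R - d.+1%:R / 2) ^+ 2 - d.+1%:R / 4 :> R.
    by rewrite -dE natrB ?(ltnW Ll)//; field.
  have p0 : 0 <= 2 ^+ L :> R by rewrite exprn_ge0.
  rewrite normrM (ger0_norm p0); have := ler_wpM2l p0 (dev _ _ cd).
  by rewrite [2 ^+ L.+1]exprS -natr1; clear; lra.
Qed.

Lemma second_moment_bound m n L : splits m -> m 0%N = 0%N ->
  (2 ^ L <= n <= 2 ^ L.+1)%N -> (100 <= L%:R :> R) ->
  \sum_(0 <= j < n) ((m j)%:R - L%:R / 2) ^+ 2 <= n%:R * L%:R :> R.
Proof.
move=> sm m0 /andP[Ln nL] L100.
have := variance_deviation _ _ _ sm m0 nL; rewrite sumrB sumr_const_nat subn0.
set S := \sum_(0 <= j < n) _ => /ler_normlW hS.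
have n2 : 2 ^+ L.+1 <= 2 * n%:R :> R by rewrite exprS ler_pM2l// -natrX ler_nat.
apply: (@le_trans _ _ (\sum_(0 <= j < n) (2 * ((m j)%:R - L.+1%:R / 2) ^+ 2 + 2^-1))).
  apply: ler_sum => i _; rewrite -(natr1 L).
  have := sqr_ge0 ((m i)%:R - (L%:R + 1) / 2 - 2^-1 : R).
  by rewrite !expr2; clear; lra.
rewrite big_split /= -mulr_sumr -/S sumr_const_nat subn0.
move: hS; rewrite -mulr_natl -[_ *+ n]mulr_natl -(natr1 L) => hS.
have n0 : 0 <= n%:R :> R by [].
have := ler_wpM2l n0 L100.
by clear -hS n2 n0; clearbody S; lra.
Qed.

End Moments.

(** * The normal distribution function *)

Section NormalDistributionFunction.
Context {R : realType}.

Definition Phi (x : R) : R := fine (normal_prob (0 : R) 1 `]-oo, x]).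

Lemma Phi_fin x : normal_prob (0 : R) 1 `]-oo, x] = (Phi x)%:E.
Proof. by rewrite fineK// fin_num_measure. Qed.

Lemma Phi_ge0 x : 0 <= Phi x.
Proof. by rewrite fine_ge0. Qed.

Lemma Phi_itv a b : a <= b ->
  normal_prob (0 : R) 1 `]a, b] = (Phi b - Phi a)%:E.
Proof.
move=> ab; rewrite EFinB -!Phi_fin.
have -> : [set` `]-oo, b]] = [set` `]-oo, a]] `|` [set` `]a, b]].
  by rewrite -itv_bndbnd_setU.
rewrite measureU//.
  by rewrite addeAC subee ?add0e// fin_num_measure.
rewrite -subset0 => t [] /=; rewrite !in_itv /= => ta /andP[at_ _].
by move: (le_lt_trans ta at_); rewrite ltxx.
Qed.

Lemma lebesgue_itv_oc (a b : R) : a <= b ->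
  lebesgue_measure `]a, b] = (b - a)%:E.
Proof.
move=> ab; rewrite lebesgue_measure_itv /= lte_fin.
by move: ab; rewrite le_eqVlt => /predU1P[->|->//]; rewrite ltxx subrr.
Qed.

Lemma Phi_upper a b C : a <= b ->
  (forall t, a <= t <= b -> normal_pdf 0 1 t <= C) -> Phi b - Phi a <= C * (b - a).
Proof.
move=> ab hC; rewrite -lee_fin -Phi_itv// /normal_prob.
apply: (@le_trans _ _ (\int[lebesgue_measure]_(x in `]a, b]) C%:E)%E).
  apply: ge0_le_integral => //=.
  - by move=> x _; rewrite lee_fin normal_pdf_ge0.
  - by apply/measurable_EFinP; apply: measurable_funTS; exact: measurable_normal_pdf.
  - by move=> x; rewrite in_itv /= => /andP[ax xb]; rewrite lee_fin hC// (ltW ax).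
by rewrite integral_cst//= lebesgue_itv_oc.
Qed.

Lemma Phi_lower a b C : a <= b -> 0 <= C ->
  (forall t, a <= t <= b -> C <= normal_pdf 0 1 t) -> C * (b - a) <= Phi b - Phi a.
Proof.
move=> ab C0 hC; rewrite -lee_fin -Phi_itv// /normal_prob.
apply: (@le_trans _ _ (\int[lebesgue_measure]_(x in `]a, b]) C%:E)%E).
  by rewrite integral_cst//= lebesgue_itv_oc.
apply: ge0_le_integral => //=.
- by apply/measurable_EFinP; apply: measurable_funTS; exact: measurable_normal_pdf.
- by move=> x; rewrite in_itv /= => /andP[ax xb]; rewrite lee_fin hC// (ltW ax).
Qed.

Lemma Phi_tails (eps T : R) : 0 < eps ->
  exists M : R, [/\ 0 < M, T <= M, Phi (- M) <= eps & 1 - eps <= Phi M].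
Proof.
move=> eps0.
pose X : measurableTypeR R -> R := idfun.
have mX : measurable_fun setT X by exact: measurable_id.
pose XX : {RV (normal_prob (0 : R) 1) >-> R} :=
  HB.pack X (isMeasurableFun.Build _ _ _ _ X mX).
have PhiE : Phi = fine \o cdf XX by apply/funext.
have up : Phi x @[x --> +oo] --> (1 : R).
  by rewrite PhiE; apply: fine_cvg; exact: cvg_cdfy1.
have dn : Phi x @[x --> -oo] --> (0 : R).
  by rewrite PhiE; apply: fine_cvg; exact: cvg_cdfNy0.
have [A [_ hA]] : \forall x \near +oo, 1 - eps <= Phi x.
  by apply: (cvgr_ge _ up); rewrite ltrBlDr ltrDl.
have [B [_ hB]] : \forall x \near -oo, Phi x <= eps.
  exact: (cvgr_le _ dn).
exists (`|A| + `|B| + `|T| + 1).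
have A0 := normr_ge0 A; have B0 := normr_ge0 B; have T0 := normr_ge0 T.
split; first by lra.
- by have := ler_norm T; lra.
- by apply: hB; have := ler_norm (- B); rewrite normrN; lra.
- by apply: hA; have := ler_norm A; lra.
Qed.

End NormalDistributionFunction.

(** * From local masses to distribution functions *)

Section CentralLimit.
Context {R : realType}.

Definition ecdf (m : nat -> nat) n (y : R) : R :=
  (\sum_(0 <= j < n) ((m j)%:R <= y)%R%:R) / n%:R.

Lemma ecdf_ge0 m n y : 0 <= ecdf m n y.
Proof. by rewrite divr_ge0// sumr_ge0. Qed.

Lemma ecdf_succ m n k :
  ecdf m n k.+1%:R = ecdf m n k%:R + occurrences m k.+1 n / n%:R.
Proof.
rewrite /ecdf /occurrences -mulrDl -big_split /=; congr (_ / _); apply: eq_bigr => j _.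
by rewrite !ler_nat -natrD; congr _%:R; lia.
Qed.

Lemma ecdf_truncn m n y : 0 <= y -> ecdf m n y = ecdf m n (Num.truncn y)%:R.
Proof.
move=> y0; rewrite /ecdf; congr (_ / _); apply: eq_bigr => j _.
by rewrite ler_nat truncn_ge_nat.
Qed.

Lemma std_normal_pdfE (t : R) :
  normal_pdf 0 1 t = normal_peak 1 * expR (- (t ^+ 2 / 2)).
Proof.
by rewrite normal_pdfE ?oner_neq0// /normal_fun subr0 expr1n mulNr.
Qed.

Lemma normal_peak_le1 : normal_peak 1 <= 1 :> R.
Proof.
rewrite /normal_peak invf_le1; last first.
  by rewrite sqrtr_gt0 expr1n mul1r mulrn_wgt0// pi_gt0.
rewrite -[leLHS]sqrtr1 ler_sqrt expr1n mul1r mulr2n; have := @pi_ge2 R; lra.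
Qed.

Lemma normal_pdf_local (x h M t : R) : 0 <= h <= 1 -> `|x| <= M ->
  x - h <= t <= x ->
  normal_pdf 0 1 x * expR (- (h * (M + 1))) <= normal_pdf 0 1 t
    <= normal_pdf 0 1 x * expR (h * (M + 1)).
Proof.
move=> /andP[h0 h1] xM /andP[t1 t2].
have w0 : 0 < normal_peak 1 :> R by rewrite normal_peak_gt0 ?oner_neq0.
rewrite !std_normal_pdfE -!mulrA !ler_pM2l// -!expRD !ler_expR.
have : `|t ^+ 2 - x ^+ 2| <= h * (2 * M + 1).
  rewrite subr_sqr normrM ler_pM// ler_norml.
    by clear -h0 t1 t2; apply/andP; split; lra.
  move: xM; rewrite ler_norml => /andP[x1 x2].
  by clear -h0 h1 t1 t2 x1 x2; apply/andP; split; lra.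
by rewrite ler_norml => /andP[? ?]; apply/andP; split; nra.
Qed.

Lemma Phi_increment (x h M : R) : 0 <= h <= 1 -> `|x| <= M ->
  h * normal_pdf 0 1 x * expR (- (h * (M + 1))) <= Phi x - Phi (x - h)
    <= h * normal_pdf 0 1 x * expR (h * (M + 1)).
Proof.
move=> h01 xM; have /andP[h0 h1] := h01.
have xh : x - h <= x by rewrite gerBl.
have loc t := normal_pdf_local _ _ _ t h01 xM.
have e (p q : R) : h * p * q = p * q * (x - (x - h)) by ring.
rewrite !e; apply/andP; split.
  apply: Phi_lower => //; first by rewrite mulr_ge0 ?normal_pdf_ge0 ?expR_ge0.
  by move=> t /loc /andP[].
by apply: Phi_upper => // t /loc /andP[].
Qed.

Lemma Phi_lipschitz (a b : R) : a <= b -> 0 <= Phi b - Phi a <= b - a.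
Proof.
move=> ab; apply/andP; split.
  have := Phi_lower _ _ _ ab (lexx 0) (fun t _ => normal_pdf_ge0 0 1 t).
  by rewrite mul0r.
rewrite -[leRHS]mul1r; apply: Phi_upper => // t _.
apply: le_trans normal_peak_le1; apply: normal_pdf_ub; exact: oner_neq0.
Qed.

(** Over the distance [h] to the left of a point of [[-M, M]] the Gaussian
density varies by a factor of at most [exp (h * (M + 1))], so the mass at a point is compared
multiplicatively with the increment of [c * Phi] and the errors can be summed
without counting the points. *)
Lemma mass_increment (x h M r rho p c : R) : 0 <= h <= 1 -> `|x| <= M ->
  `|r| <= rho -> rho <= 1 -> 0 <= c -> p = c * (h * normal_pdf 0 1 x * (1 + r)) ->
  `|p - c * (Phi x - Phi (x - h))| <=
    c * (expR (rho + h * (M + 1)) - 1) * (Phi x - Phi (x - h)).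
Proof.
move=> h01 xM rrho rho1 c0 ->.
have /andP[lo up] := Phi_increment _ _ _ h01 xM.
have /andP[h0 h1] := h01.
set D := Phi x - Phi (x - h) in lo up *; set q := h * normal_pdf 0 1 x in lo up *.
have M0 : 0 <= M by apply: le_trans xM.
set eta := h * (M + 1) in lo up *.
have eta0 : 0 <= eta by rewrite mulr_ge0 ?addr_ge0.
have q0 : 0 <= q by rewrite mulr_ge0 ?normal_pdf_ge0.
have rho0 : 0 <= rho by apply: le_trans rrho.
have D0 : 0 <= D by apply: le_trans lo; rewrite mulr_ge0 ?expR_ge0.
have qup : q <= D * expR eta.
  have := ler_wpM2r (expR_ge0 eta) lo.
  by rewrite -mulrA [expR (- _) * _]mulrC expRxMexpNx_1 mulr1.
have qlo : D * expR (- eta) <= q.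
  have := ler_wpM2r (expR_ge0 (- eta)) up.
  by rewrite -mulrA expRxMexpNx_1 mulr1.
move: rrho; rewrite ler_norml => /andP[r1 r2].
rewrite -mulrBr normrM (ger0_norm c0) -mulrA ler_wpM2l//.
have er := expR_ge1Dx rho; have eeta := expR_ge1Dx (- eta).
have eS := expR_ge1Dx (rho + eta).
have U : q * (1 + r) <= D * expR (rho + eta).
  rewrite expRD [expR rho * _]mulrC mulrA; apply: ler_pM => //; clear -er r1 r2 rho1; lra.
have V : D * (1 - eta - rho) <= q * (1 + r).
  apply: (@le_trans _ _ (D * expR (- eta) * (1 - rho))).
    rewrite -mulrA ler_wpM2l//; have : 0 <= 1 - rho by clear -rho1; lra.
    move=> rho1'; have := ler_wpM2r rho1' eeta; have := mulr_ge0 eta0 rho0; clear; lra.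
  apply: ler_pM => //; first by rewrite mulr_ge0 ?expR_ge0.
    by clear -rho1; lra.
  by clear -r1; lra.
have W : D * (1 + (rho + eta)) <= D * expR (rho + eta) by rewrite ler_wpM2l.
by rewrite ler_norml; clear -U V W; clearbody D q eta; apply/andP; split; lra.
Qed.

End CentralLimit.

Section CentralLimitTheorem.
Context {R : realType}.

Lemma ecdf_telescope m n (c delta : R) (X : nat -> R) k1 k2 : (k1 <= k2)%N ->
  (forall k, (k1 <= k < k2)%N ->
     `|occurrences m k.+1 n / n%:R - c * (Phi (X k.+1) - Phi (X k))| <=
       c * delta * (Phi (X k.+1) - Phi (X k))) ->
  `|ecdf m n k2%:R - ecdf m n k1%:R - c * (Phi (X k2) - Phi (X k1))| <=
     c * delta * (Phi (X k2) - Phi (X k1)).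
Proof.
elim: k2 => [|k2 IH]; first by rewrite leqn0 => /eqP->; rewrite !subrr !mulr0 subrr normr0.
rewrite leq_eqVlt => /predU1P[<-|]; first by rewrite !subrr !mulr0 subrr normr0.
rewrite ltnS => k12 H.
have H2 := H k2; rewrite k12 ltnSn in H2; have {}H2 := H2 isT.
have {}IH : `|ecdf m n k2%:R - ecdf m n k1%:R - c * (Phi (X k2) - Phi (X k1))| <=
     c * delta * (Phi (X k2) - Phi (X k1)).
  by apply: IH => // k /andP[h1 h2]; apply: H; rewrite h1 ltnW.
rewrite ecdf_succ.
have -> : ecdf m n k2%:R + occurrences m k2.+1 n / n%:R - ecdf m n k1%:R -
    c * (Phi (X k2.+1) - Phi (X k1)) =
  (ecdf m n k2%:R - ecdf m n k1%:R - c * (Phi (X k2) - Phi (X k1))) +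
  (occurrences m k2.+1 n / n%:R - c * (Phi (X k2.+1) - Phi (X k2))) by ring.
apply: (le_trans (ler_normD _ _)).
have -> : c * delta * (Phi (X k2.+1) - Phi (X k1)) =
  c * delta * (Phi (X k2) - Phi (X k1)) + c * delta * (Phi (X k2.+1) - Phi (X k2)).
  by ring.
exact: lerD.
Qed.

(** The value whose standardization by mean [L / 2] and variance [L / 4]
is [x]. *)
Definition unscale (L : nat) (x : R) : R := L%:R / 2 + x * (Num.sqrt L%:R / 2).

Lemma mass_rescale (A w e s r : R) : w != 0 -> s != 0 ->
  A * e / s * (1 + r) = A / (2 * w) * (2 / s * (w * e) * (1 + r)).
Proof. by move=> w0 s0; field; rewrite w0 s0. Qed.

(** The increments of [mass_increment] telescope over the integers of the
window; moving the two ends to integers costs at most [h] on each side, where [h] is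
the distance [2 / sqrt L] of neighbouring standardized integers.  The value of
[c] makes [A / sqrt L] equal to [c * h * normal_peak 1]. *)
Lemma window_estimate (m : nat -> nat) (A C M : R) : 0 < A -> 0 < C ->
  local_limit_law m A C -> 0 < M ->
  let c := A / (2 * normal_peak 1) in
  exists2 Q : R, 0 < Q & forall (L n : nat) (a b : R),
    (2 ^ L <= n <= 2 ^ L.+1)%N -> Q <= Num.sqrt L%:R ->
    - M <= a -> a <= b -> b <= M ->
    `|ecdf m n (unscale L b) - ecdf m n (unscale L a) - c * (Phi b - Phi a)|
      <= Q / Num.sqrt L%:R.
Proof.
move=> A0 C0 lll M0 c.
have w0 : 0 < normal_peak 1 :> R by rewrite normal_peak_gt0 ?oner_neq0.
have c0 : 0 < c by rewrite divr_gt0 ?mulr_gt0.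
pose K1 := C * (1 + M ^+ 3).
have M3 : 0 < M ^+ 3 by rewrite exprn_gt0.
have K10 : 0 < K1 by rewrite mulr_gt0// addr_gt0.
pose K := K1 + 2 * (M + 1).
have K0 : 0 < K by rewrite /K; clear -K10 M0; clearbody K1; lra.
pose Q0 := c * (K * expR 1) + 4 * c.
have Q00 : 0 < Q0.
  apply: addr_gt0; last exact: mulr_gt0.
  by apply: mulr_gt0 => //; apply: mulr_gt0 => //; exact: expR_gt0.
exists (33 + M ^+ 3 + M + K + Q0).
  by clear -M3 M0 K0 Q00; clearbody Q0 K; lra.
move=> L n a b Ln; set s : R := Num.sqrt L%:R => sQ Ma ab bM.
have s2 : s ^+ 2 = L%:R by rewrite sqr_sqrtr.
have [s32 sM3 sM sK] : [/\ 32 < s, M ^+ 3 <= s, M <= s & K <= s].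
  by clear -sQ M3 M0 K0 Q00; clearbody s Q0 K; split; lra.
have s0 : 0 < s by clear -s32; lra.
pose h : R := 2 / s.
have h0 : 0 < h by rewrite divr_gt0.
have h1 : h <= 1 by rewrite ler_pdivrMr//; clear -s32; lra.
pose X (k : nat) : R := (k%:R - L%:R / 2) * h.
have XS k : X k.+1 - h = X k by rewrite /X -(natr1 k); ring.
have unscaleK x : (unscale L x - L%:R / 2) * h = x.
  by rewrite /unscale -/s /h; field; rewrite gt_eqF.
have unscale_ge0 x : - M <= x -> 0 <= unscale L x.
  move=> Mx; rewrite /unscale -/s -s2.
  have -> : s ^+ 2 / 2 + x * (s / 2) = s / 2 * (s + x) by field.
  by rewrite mulr_ge0 ?divr_ge0 ?(ltW s0)//; clear -Mx sM; lra.
have unscale_le x y : x <= y -> unscale L x <= unscale L y.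
  by move=> xy; rewrite lerD2l ler_wpM2r// divr_ge0 ?(ltW s0).
pose k1 := Num.truncn (unscale L a); pose k2 := Num.truncn (unscale L b).
have Mb : - M <= b by exact: le_trans ab.
have k12 : (k1 <= k2)%N by apply: le_truncn; exact: unscale_le.
have Xle x k : ((k%:R <= unscale L x) = (X k <= x)).
  by rewrite -[in RHS](unscaleK x) /X ler_pM2r// lerD2r.
have Xgt x k : ((unscale L x < k%:R) = (x < X k)).
  by rewrite !ltNge Xle.
have [Xa1 Xa2] : X k1 <= a /\ a < X k1.+1.
  by rewrite -Xle -Xgt; have /andP[] := truncn_itv (unscale_ge0 _ Ma).
have [Xb1 Xb2] : X k2 <= b /\ b < X k2.+1.
  by rewrite -Xle -Xgt; have /andP[] := truncn_itv (unscale_ge0 _ Mb).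
have Xmono i j : (i <= j)%N -> X i <= X j.
  by move=> ij; rewrite /X ler_pM2r// lerD2r ler_nat.
have h01 : 0 <= h <= 1 by rewrite (ltW h0).
have hM : K1 / s + h * (M + 1) = K / s by rewrite /h /K; field; rewrite gt_eqF.
have Ks1 : K / s <= 1 by rewrite ler_pdivrMr// mul1r.
have Ks0 : 0 <= K / s by rewrite divr_ge0 ?ltW.
pose delta := expR (K / s) - 1.
have tele : `|ecdf m n k2%:R - ecdf m n k1%:R - c * (Phi (X k2) - Phi (X k1))| <=
     c * delta * (Phi (X k2) - Phi (X k1)).
  apply: ecdf_telescope => // k /andP[k1k kk2].
  have xM : `|X k.+1| <= M.
    rewrite ler_norml (le_trans _ (le_trans Xb1 bM)) ?Xmono// andbT.
    by rewrite (le_trans Ma)// (le_trans (ltW Xa2))// Xmono.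
  have x3 : `|X k.+1| ^+ 3 <= M ^+ 3 by rewrite lerXn2r ?nnegrE// ltW.
  have xk : `|L%:R / 2 + X k.+1 * s / 2 - k.+1%:R| <= 1.
    have -> : L%:R / 2 + X k.+1 * s / 2 - k.+1%:R = 0.
      by rewrite /X /h; field; rewrite gt_eqF.
    by rewrite normr0.
  have [r rC ->] := lll L n k.+1 (X k.+1) Ln s32 (le_trans x3 sM3) xk.
  rewrite -(XS k) /delta -hM; apply: mass_increment => //; last 1 first.
  - by rewrite std_normal_pdfE mulNr; apply: mass_rescale; rewrite gt_eqF.
  - apply: (le_trans rC); rewrite -/s /K1 -mulrA ler_pM2l//.
    by rewrite ler_pM2r ?invr_gt0// lerD2l.
  - apply: le_trans Ks1; rewrite ler_pM2r ?invr_gt0// /K lerDl.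
    by clear -M0; lra.
  - exact: ltW.
have dle : delta <= K / s * expR 1.
  have := expR_sub1_norm (K / s) 1; rewrite ger0_norm// => /(_ Ks1).
  by move=> /(le_trans (ler_norm _)).
have XS' k : X k.+1 = X k + h by rewrite -(XS k) subrK.
rewrite XS' in Xa2; rewrite XS' in Xb2.
have /andP[pa1 pa2] := Phi_lipschitz _ _ Xa1.
have /andP[pb1 pb2] := Phi_lipschitz _ _ Xb1.
have PX : 0 <= Phi (X k2) - Phi (X k1) <= 1.
  have /andP[-> _] := Phi_lipschitz _ _ (Xmono _ _ k12).
  have p1 : Phi (X k2) <= 1 by rewrite -lee_fin -Phi_fin probability_le1.
  have := Phi_ge0 (X k1); move: p1; clear; lra.
rewrite (ecdf_truncn _ _ _ (unscale_ge0 _ Mb)) (ecdf_truncn _ _ _ (unscale_ge0 _ Ma)) -/k1 -/k2.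
have delta0 : 0 <= delta by rewrite subr_ge0 -[leLHS]expR0 ler_expR.
have T : c * delta * (Phi (X k2) - Phi (X k1)) <= c * (K / s * expR 1).
  have /andP[? ?] := PX.
  rewrite -[leRHS]mulr1; apply: ler_pM => //; first exact: mulr_ge0 (ltW c0) delta0.
  by rewrite ler_pM2l.
have hc : c * h = 2 * c / s by rewrite /h mulrCA mulrA.
have B1 : `|c * ((Phi b - Phi (X k2)) - (Phi a - Phi (X k1)))| <= 4 * c / s.
  rewrite normrM (gtr0_norm c0).
  have -> : 4 * c / s = c * (2 * h) by rewrite /h; ring.
  rewrite ler_pM2l// ler_norml; clear -pa1 pa2 pb1 pb2 Xa2 Xb2; clearbody h.
  by apply/andP; split; lra.
have -> : ecdf m n k2%:R - ecdf m n k1%:R - c * (Phi b - Phi a) =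
  (ecdf m n k2%:R - ecdf m n k1%:R - c * (Phi (X k2) - Phi (X k1))) -
  c * ((Phi b - Phi (X k2)) - (Phi a - Phi (X k1))) by ring.
apply: (le_trans (ler_normB _ _)).
apply: (le_trans (lerD (le_trans tele T) B1)).
have -> : c * (K / s * expR 1) + 4 * c / s = Q0 / s by rewrite /Q0; ring.
rewrite ler_pM2r ?invr_gt0//; clear -M3 M0 K0; clearbody Q0 K; lra.
Qed.

End CentralLimitTheorem.

(** * Normalization and the central limit theorem *)

Section CentralLimitCounting.
Context {R : realType}.

Lemma trunc_log_bounds n : (0 < n)%N ->
  (2 ^ trunc_log 2 n <= n <= 2 ^ (trunc_log 2 n).+1)%N.
Proof. by move=> n0; rewrite trunc_logP// ltnW// trunc_log_ltn. Qed.

Lemma sqrt_trunc_log_infty (Q : R) :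
  \forall n \near \oo, Q <= Num.sqrt (trunc_log 2 n)%:R.
Proof.
exists (2 ^ (Num.truncn (Q ^+ 2)).+1)%N => //= n /= nQ.
have [Q0|/ltW Q0] := leP Q 0; first by rewrite (le_trans Q0)// sqrtr_ge0.
have -> : Q = Num.sqrt (Q ^+ 2) by rewrite sqrtr_sqr ger0_norm.
by rewrite ler_wsqrtr// (le_trans (ltW (truncnS_gt _)))// ler_nat trunc_log_max.
Qed.

Lemma ecdf_le1 m n (y : R) : ecdf m n y <= 1.
Proof.
rewrite /ecdf; have [->|n0] := posnP n; first by rewrite invr0 mulr0.
rewrite ler_pdivrMr ?ltr0n// mul1r.
rewrite (@le_trans _ _ (\sum_(0 <= j < n) 1))//; last by rewrite sumr_const_nat subn0.
by apply: ler_sum => j _; rewrite (ler_nat R _ 1) leq_b1.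
Qed.

(** Chebyshev's inequality for the empirical distribution of [m] on [0, n). *)
Lemma ecdf_concentration m n L (M : R) : splits m -> m 0%N = 0%N ->
  (2 ^ L <= n <= 2 ^ L.+1)%N -> 100 <= L%:R :> R -> 0 < M ->
  1 - 4 / M ^+ 2 <= ecdf m n (unscale L M) - ecdf m n (unscale L (- M)).
Proof.
move=> sm m0 Ln L100 M0; have sec := second_moment_bound _ _ _ sm m0 Ln L100.
have n0 : 0 < n%:R :> R.
  by case/andP: Ln => Ln _; rewrite ltr0n (leq_trans _ Ln)// expn_gt0.
have L0 : 0 < L%:R :> R by lra.
pose s : R := Num.sqrt L%:R.
have s0 : 0 < s by rewrite sqrtr_gt0.
have s2 : s ^+ 2 = L%:R by rewrite sqr_sqrtr// ltW.
rewrite /ecdf -mulrBl -sumrB ler_pdivlMr//.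
(* [q] makes the quadratic [q y ^ 2] reach 1 at the ends of the window. *)
pose q : R := 4 / (M ^+ 2 * L%:R).
have q0 : 0 <= q by rewrite divr_ge0// mulr_ge0 ?sqr_ge0// ltW.
apply: (@le_trans _ _ (\sum_(0 <= j < n) (1 - q * ((m j)%:R - L%:R / 2) ^+ 2))).
  rewrite sumrB -mulr_sumr sumr_const_nat subn0.
  have := ler_wpM2l q0 sec.
  have -> : q * (n%:R * L%:R) = 4 / M ^+ 2 * n%:R.
    by rewrite /q; field; rewrite !gt_eqF.
  by clear; lra.
apply: ler_sum => j _; rewrite /unscale -/s.
have far y : M * (s / 2) <= `|y| -> 1 - q * y ^+ 2 <= 0.
  move=> My; rewrite subr_le0 -real_normK ?num_real//.
  have q1 : q * (M * (s / 2)) ^+ 2 = 1.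
    by rewrite /q -s2; field; rewrite !gt_eqF.
  rewrite -q1 ler_wpM2l// lerXn2r ?nnegrE// mulr_ge0 ?divr_ge0// ltW//.
have Ms0 : 0 < M * (s / 2) by rewrite mulr_gt0// divr_gt0.
have near0 : 0 <= q * ((m j)%:R - L%:R / 2) ^+ 2 by rewrite mulr_ge0 ?sqr_ge0.
have [h1|h1] := leP (m j)%:R (L%:R / 2 + - M * (s / 2));
  have [h2|h2] := leP (m j)%:R (L%:R / 2 + M * (s / 2)) => /=.
- by rewrite subrr; apply: far; rewrite ler0_norm; clear -h1 Ms0; lra.
- by exfalso; clear -h1 h2 Ms0; lra.
- by clear -near0; lra.
- by rewrite subrr; apply: far; rewrite ger0_norm; clear -h2 Ms0; lra.
Qed.

Definition std_cdf m n (x : R) := ecdf m n (unscale (trunc_log 2 n) x).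

Lemma window_cvg (m : nat -> nat) (A C a b : R) : 0 < A -> 0 < C ->
  local_limit_law m A C -> a <= b ->
  std_cdf m n b - std_cdf m n a @[n --> \oo] -->
    A / (2 * normal_peak 1) * (Phi b - Phi a).
Proof.
move=> A0 C0 lll ab; pose M := `|a| + `|b| + 1.
have M0 : 0 < M by rewrite ltr_wpDl// addr_ge0.
have [Q Q0 HQ] := window_estimate m A C M A0 C0 lll M0.
have Ma : - M <= a.
  by have := ler_norm (- a); rewrite normrN /M; have := normr_ge0 b; lra.
have bM : b <= M by have := ler_norm b; rewrite /M; have := normr_ge0 a; lra.
apply/cvgrPdist_le => e e0; near=> n.
have n0 : (0 < n)%N by near: n; exists 1%N.
have Qs : Q <= Num.sqrt (trunc_log 2 n)%:R by near: n; exact: sqrt_trunc_log_infty.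
have es : Q / e <= Num.sqrt (trunc_log 2 n)%:R by near: n; exact: sqrt_trunc_log_infty.
rewrite distrC; apply: (le_trans (HQ _ _ _ _ (trunc_log_bounds _ n0) Qs Ma ab bM)).
rewrite ler_pdivrMr; last by rewrite (lt_le_trans Q0).
by rewrite mulrC -ler_pdivrMr.
Unshelve. all: by end_near. Qed.

(** The mass of a large window tends to [c * (Phi M - Phi (- M))] by the
local formula and is close to 1 by concentration. *)
Lemma normalization (m : nat -> nat) (A C : R) : 0 < A -> 0 < C ->
  splits m -> m 0%N = 0%N -> local_limit_law m A C ->
  A / (2 * normal_peak 1) = 1.
Proof.
move=> A0 C0 sm m0 lll; set c := _ / _.
have c0 : 0 < c by rewrite divr_gt0 ?mulr_gt0 ?normal_peak_gt0 ?oner_neq0.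
have bounds M : 0 < M -> 1 - 4 / M ^+ 2 <= c * (Phi M - Phi (- M)) <= 1.
  move=> M0; have MM : - M <= M by lra.
  have W := window_cvg m A C _ _ A0 C0 lll MM; rewrite -/c in W.
  apply/andP; split.
    apply: (cvgr_to_ge W); near=> n.
    have n0 : (0 < n)%N by near: n; exists 1%N.
    have s10 : 10 <= Num.sqrt (trunc_log 2 n)%:R :> R.
      by near: n; exact: sqrt_trunc_log_infty.
    apply: ecdf_concentration => //; first exact: trunc_log_bounds.
    rewrite -[leRHS]sqr_sqrtr//; move: s10; move: (Num.sqrt _) => s; clear.
    by rewrite expr2; nra.
  apply: (cvgr_to_le W); near=> n.
  by have := ecdf_le1 m n (unscale (trunc_log 2 n) M);
     have := ecdf_ge0 m n (unscale (trunc_log 2 n) (- M)); rewrite /std_cdf; lra.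
have sandwich eps : 0 < eps -> 1 - eps <= c /\ c * (1 - 2 * eps) <= 1.
  move=> eps0; have [M [M0 TM lo up]] := Phi_tails eps (4 / eps) eps0.
  have /andP[b1 b2] := bounds M M0.
  have D1 : 1 - 2 * eps <= Phi M - Phi (- M) by lra.
  have D2 : Phi M - Phi (- M) <= 1.
    have : Phi M <= 1 by rewrite -lee_fin -Phi_fin probability_le1.
    by have := Phi_ge0 (- M); lra.
  have M4 : 4 / M ^+ 2 <= eps \/ 1 <= eps.
    have [e1|/ltW e1] := leP 1 eps; [by right|left].
    rewrite ler_pdivrMr ?exprn_gt0//.
    move: TM; rewrite ler_pdivrMr// => TM; have := ler_wpM2l (ltW M0) TM.
    have : M * eps <= M * 1 by rewrite ler_wpM2l// ltW.
    by rewrite expr2; clear -TM; lra.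
  have cD := ler_wpM2l (ltW c0) D1; have cD2 := ler_wpM2l (ltW c0) D2.
  by case: M4 => ?; split; lra.
apply/eqP; rewrite eq_le; apply/andP; split; apply/ler_addgt0Pr => e e0.
  have ec : 0 < e / (2 * c) by rewrite divr_gt0// mulr_gt0.
  have [_] := sandwich _ ec.
  rewrite mulrBr mulr1 [c * (2 * _)](_ : _ = e); last by field; rewrite gt_eqF.
  by rewrite lerBlDr.
by have [h _] := sandwich _ e0; rewrite -lerBlDr.
Unshelve. all: by end_near. Qed.

(** Convergence on windows and absence of escaping mass control the lower tail
as well. *)
Theorem counting_clt (m : nat -> nat) (A C x : R) : 0 < A -> 0 < C ->
  splits m -> m 0%N = 0%N -> local_limit_law m A C ->
  std_cdf m n x @[n --> \oo] --> Phi x.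
Proof.
move=> A0 C0 sm m0 lll.
have c1 := normalization m A C A0 C0 sm m0 lll.
apply/cvgrPdist_le => e e0.
have e4 : 0 < e / 4 by rewrite divr_gt0.
have [M [M0 xM lo up]] := Phi_tails (e / 4) `|x| e4.
have [Mx xM'] : - M <= x /\ x <= M by move: xM; rewrite ler_norml => /andP[].
have W1 := window_cvg m A C _ _ A0 C0 lll Mx.
have W2 := window_cvg m A C _ _ A0 C0 lll (le_trans Mx xM').
rewrite c1 mul1r in W1; rewrite c1 mul1r in W2.
near=> n.
have h1 : `|Phi x - Phi (- M) - (std_cdf m n x - std_cdf m n (- M))| <= e / 4.
  by near: n; exact: (cvgrPdist_le _ _).1.
have h2 : `|Phi M - Phi (- M) - (std_cdf m n M - std_cdf m n (- M))| <= e / 4.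
  by near: n; exact: (cvgrPdist_le _ _).1.
have h3 : std_cdf m n M <= 1 := ecdf_le1 _ _ _.
have h4 : 0 <= std_cdf m n (- M) := ecdf_ge0 _ _ _.
have h5 := Phi_ge0 (- M).
move: h1 h2; rewrite !ler_norml => /andP[a1 a2] /andP[b1 b2].
by clear -a1 a2 b1 b2 h3 h4 h5 lo up; apply/andP; split; lra.
Unshelve. all: by end_near. Qed.

End CentralLimitCounting.

(** * Doubling and periodic fluctuations *)

Section Doubling.
Context {R : realType}.

Lemma sum_double (f : nat -> R) (m : nat -> nat) n : splits m ->
  \sum_(0 <= j < n.*2) f (m j) = \sum_(0 <= j < n) (f (m j) + f (m j).+1).
Proof.
move=> sm; elim: n => [|n IH]; first by rewrite !big_geq.
rewrite doubleS !big_nat_recr//= IH -addrA; congr (_ + _).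
by case: (sm n) => -[-> ->]; rewrite // addrC.
Qed.

(** Subtracting the identities at [n + 1] and [n] leaves one index on the
right and two on the left; the values [k = m n] and [k = m n + 1] determine
both. *)
Lemma splits_of_counts (m : nat -> nat) :
  (forall n k : nat, (0 < n)%N -> \sum_(0 <= j < n.*2) (m j == k)%:R =
     \sum_(0 <= j < n) ((m j == k)%:R + ((m j).+1 == k)%:R) :> R) ->
  splits m.
Proof.
move=> H n.
have {}H N k : \sum_(0 <= j < N.*2) (m j == k)%:R =
     \sum_(0 <= j < N) ((m j == k)%:R + ((m j).+1 == k)%:R) :> R.
  by case: N => [|N]; [rewrite !big_geq | exact: H].
have E k : ((m n.*2 == k) + (m n.*2.+1 == k) = (m n == k) + ((m n).+1 == k))%N.
  apply/eqP; rewrite -(@eqr_nat R) !natrD.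
  have := H n.+1 k; rewrite doubleS !big_nat_recr//= H -addrA => /addrI ->.
  by [].
have := E (m n); have := E (m n).+1.
rewrite !eqxx [_.+1 == m n]gtn_eqF// [m n == _]ltn_eqF//.
by do 4 case: eqP => //=; move=> *; solve [by left | by right | lia].
Qed.

Lemma log2_double (n : nat) : (0 < n)%N ->
  log2 n.*2%:R = log2 n%:R + 1 :> R.
Proof.
move=> n0; rewrite /log2 -muln2 natrM lnM ?posrE ?ltr0n// mulrDl mulfV//.
by rewrite gt_eqF// ln_gt0// ltr1n.
Qed.

Lemma log2_shift_inj (p q a : nat) : (0 < p)%N -> (0 < q)%N ->
  log2 p%:R = log2 q%:R + a%:R :> R -> p = (q * 2 ^ a)%N.
Proof.
move=> p0 q0; have l2 : 0 < ln 2 :> R by rewrite ln_gt0// ltr1n.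
rewrite /log2 => e.
have : ln p%:R = ln (q%:R * 2 ^+ a) :> R.
  rewrite lnM ?posrE ?exprn_gt0 ?ltr0n// lnXn// -[ln 2 *+ a]mulr_natl.
  have l20 : ln 2 != 0 :> R by rewrite gt_eqF.
  by rewrite -[LHS](divfK l20) e mulrDl divfK.
move=> /ln_inj; rewrite !posrE ltr0n p0 mulr_gt0 ?exprn_gt0 ?ltr0n//.
by move=> /(_ isT isT) /eqP; rewrite -natrX -natrM eqr_nat => /eqP.
Qed.

(** If [log2 p] and [log2 q] differ by an integer then [p] and [q] differ by a
power of two, so [g] factors through the class of [log2 n] modulo 1.  Outside
the countably many classes met, any value of [g] does. *)
Lemma periodic_interpolation (g : nat -> R) (B : R) :
  (forall n, (0 < n)%N -> `|g n| <= B) ->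
  (forall n, (0 < n)%N -> g n.*2 = g n) ->
  exists G : R -> R, [/\ bounded_fun G, periodic G 1 &
    forall n, (0 < n)%N -> G (log2 n%:R) = g n].
Proof.
move=> gB g2.
pose S (x : R) : set nat :=
  [set n | (0 < n)%N /\ exists z : int, x = log2 n%:R + z%:~R].
pose G x := g (xget 1%N (S x)).
have gpow n a : (0 < n)%N -> g (n * 2 ^ a)%N = g n.
  move=> n0; elim: a => [|a IH]; first by rewrite muln1.
  by rewrite expnS mulnCA mul2n g2 ?IH// muln_gt0 n0 expn_gt0.
have S0 x : (0 < xget 1%N (S x))%N by case: xgetP => [n _ []|].
exists G; split.
- exists B; split; first exact: num_real.
  by move=> y /ltW By x _; apply: le_trans By; exact: gB.
- move=> x; congr (g (xget _ _)); apply/seteqP; split => n [n0 [z e]]; split=> //.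
    by exists (z - 1); rewrite intrB addrA -e addrK.
  by exists (z + 1); rewrite intrD addrA -e.
- move=> n n0; rewrite /G.
  have : S (log2 n%:R) n by split => //; exists 0; rewrite addr0.
  move=> /(xgetI 1%N) [p0 [z e]]; move: (xget _ _) p0 z e => p p0 z e.
  case: (intP z) e => [|a|a] e.
  + by rewrite (log2_shift_inj n p 0)// ?muln1.
  + by rewrite (log2_shift_inj n p a.+1 n0 p0 e) gpow.
  + rewrite (log2_shift_inj p n a.+1 p0 n0) ?gpow//.
    by rewrite e mulrNz subrK.
Qed.

Lemma log2_trunc_log n : (0 < n)%N ->
  (trunc_log 2 n)%:R <= log2 (n%:R : R) < (trunc_log 2 n)%:R + 1.
Proof.
move=> n0; have l2 : 0 < ln 2 :> R by rewrite ln_gt0// ltr1n.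
have nR : 0 < n%:R :> R by rewrite ltr0n.
rewrite /log2 ler_pdivlMr// ltr_pdivrMr// natr1 !mulr_natl -!lnXn//.
rewrite ler_ln ?ltr_ln ?posrE ?exprn_gt0// -!natrX ler_nat ltr_nat.
by rewrite trunc_logP// trunc_log_ltn.
Qed.

Lemma lamE n : (0 < n)%N -> lam R n = (trunc_log 2 n)%:R.
Proof.
move=> n0; rewrite /lam (@floor_def _ _ (trunc_log 2 n)%:Z)//.
by have := log2_trunc_log n n0; rewrite intrD.
Qed.

Definition mean m n : R := (\sum_(0 <= j < n) (m j)%:R) / n%:R.

Definition var m n : R := (\sum_(0 <= j < n) ((m j)%:R - mean m n) ^+ 2) / n%:R.

Lemma mean_double m n : splits m -> (0 < n)%N -> mean m n.*2 = mean m n + 2^-1.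
Proof.
move=> sm n0; have nR : n%:R != 0 :> R by rewrite pnatr_eq0 -lt0n.
rewrite /mean (sum_double (fun i => i%:R))//.
rewrite (eq_bigr (fun j => 2 * (m j)%:R + 1)); last first.
  by move=> j _; rewrite -(natr1 (m j)); ring.
rewrite big_split /= -mulr_sumr sumr_const_nat subn0.
by rewrite -muln2 natrM; field; rewrite nR.
Qed.

Lemma var_double m n : splits m -> (0 < n)%N -> var m n.*2 = var m n + 4^-1.
Proof.
move=> sm n0; have nR : n%:R != 0 :> R by rewrite pnatr_eq0 -lt0n.
rewrite /var (sum_double (fun i => (i%:R - mean m n.*2) ^+ 2))// mean_double//.
rewrite (eq_bigr (fun j => 2 * ((m j)%:R - mean m n) ^+ 2 + 2^-1)); last first.
  by move=> j _; rewrite -(natr1 (m j)); field.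
rewrite big_split /= -mulr_sumr sumr_const_nat subn0 -mulr_natl.
by rewrite -muln2 natrM; field; rewrite nR.
Qed.

Lemma moments_bound m n : splits m -> m 0%N = 0%N -> (0 < n)%N ->
  `|mean m n - log2 n%:R / 2| <= 3 /\ `|var m n - log2 n%:R / 4| <= 9.
Proof.
move=> sm m0 n0; have /andP[Ln nL] := trunc_log_bounds n n0.
have /andP[l1 l2] := log2_trunc_log n n0.
set l := (trunc_log 2 n).+1 in nL.
have lR : l%:R = (trunc_log 2 n)%:R + 1 :> R by rewrite natr1.
have nR : 0 < n%:R :> R by rewrite ltr0n.
have n2 : 2 ^+ l <= 2 * n%:R :> R by rewrite exprS ler_pM2l// -natrX ler_nat.
pose e : R := mean m n - l%:R / 2.
have D1 : `|e| <= 2.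
  have -> : e = (\sum_(0 <= j < n) ((m j)%:R - l%:R / 2)) / n%:R.
    rewrite sumrB sumr_const_nat subn0 -mulr_natl /e /mean.
    by field; rewrite gt_eqF.
  rewrite normrM [`|_^-1|]gtr0_norm ?invr_gt0// ler_pdivrMr//.
  exact: le_trans (mean_deviation _ _ _ sm m0 nL) n2.
pose f : R := var m n + e ^+ 2 - l%:R / 4.
have D2 : `|f| <= 4.
  have -> : f = (\sum_(0 <= j < n) (((m j)%:R - l%:R / 2) ^+ 2 - l%:R / 4)) / n%:R.
    rewrite /f /var.
    rewrite [in RHS](eq_bigr (fun j => (((m j)%:R - mean m n) ^+ 2 +
      2 * e * (m j)%:R) + (e ^+ 2 - 2 * e * mean m n - l%:R / 4))); last first.
      by move=> j _; rewrite /e; ring.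
    rewrite 2!big_split /= -mulr_sumr sumr_const_nat subn0 -[in RHS]mulr_natl.
    rewrite (_ : \sum_(0 <= j < n) (m j)%:R = mean m n * n%:R); last first.
      by rewrite /mean divfK// gt_eqF.
    by field; rewrite gt_eqF.
  rewrite normrM [`|_^-1|]gtr0_norm ?invr_gt0// ler_pdivrMr//.
  apply: le_trans (variance_deviation _ _ _ sm m0 nL) _.
  by clear -n2; lra.
have e2 : e ^+ 2 <= 4.
  rewrite -real_normK ?num_real// (_ : 4 = 2 ^+ 2); last by ring.
  by rewrite lerXn2r ?nnegrE.
have e20 : 0 <= e ^+ 2 by rewrite sqr_ge0.
have -> : mean m n - log2 n%:R / 2 = e + (l%:R - log2 n%:R) / 2.
  by rewrite /e; field.
have -> : var m n - log2 n%:R / 4 = f - e ^+ 2 + (l%:R - log2 n%:R) / 4.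
  by rewrite /f; field.
move: D1 D2; rewrite lR !ler_norml => /andP[H1 H2] /andP[H3 H4].
clearbody e f; clear -l1 l2 e2 e20 H1 H2 H3 H4.
by split; apply/andP; split; lra.
Qed.

End Doubling.

(** * Uniform random indices *)

Section UniformIndex.
Context d (Omega : measurableType d) (R : realType) (P : probability Omega R).

(** The sets where the index equals [j] partition the sample space, and
those with [n <= j] are null. *)
Lemma uniform_integral (n : nat) (X : {RV P >-> nat}) (f : nat -> R) :
  uniform_below n X -> (forall j, 0 <= f j) ->
  (\int[P]_w (f (X w))%:E = ((\sum_(0 <= j < n) f j) / n%:R)%:E)%E.
Proof.
move=> uX f0.
have mX (A : set nat) : measurable (X @^-1` A).
  by rewrite -[_ @^-1` _]setTI; exact: measurable_funP.
pose F k := X @^-1` [set k].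
have UF : \bigcup_k F k = setT.
  by rewrite -subTset => w _; exists (X w).
rewrite -UF ge0_integral_bigcup//=; last first.
- by move=> i j _ _ [w [<- <-]].
- by move=> w _; rewrite lee_fin.
- rewrite UF; apply/measurable_EFinP.
  by apply: (measurableT_comp (f := f)) => //; exact: measurable_funP.
- by move=> k; exact: mX.
have e k : (\int[P]_(w in F k) (f (X w))%:E =
    (if (k < n)%N then f k / n%:R else 0)%:E)%E.
  rewrite (eq_integral (fun=> (f k)%:E)); last by move=> w; rewrite inE => ->.
  rewrite integral_cst//=; last exact: mX.
  rewrite (uX k) -EFinM; case: ifP => // _; by rewrite mulr0.
rewrite (eq_eseriesr (fun k _ => e k)) (nneseries_split 0 n); last first.
  by move=> k _; rewrite lee_fin; case: ifP => // _; rewrite divr_ge0.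
rewrite add0n eseries0 ?adde0; last first.
  by move=> k nk _ /=; rewrite ltnNge nk.
rewrite sumEFin mulr_suml; congr EFin.
by apply: eq_big_nat => k /andP[_ ->].
Qed.

Lemma uniform_prob (n : nat) (X : {RV P >-> nat}) (A : pred nat) :
  uniform_below n X ->
  P [set w | A (X w)] = ((\sum_(0 <= j < n) (A j)%:R) / n%:R : R)%:E.
Proof.
move=> uX; rewrite -(uniform_integral _ _ _ uX (fun j => ler0n _ _)).
have mA : measurable [set w | A (X w)].
  rewrite (_ : [set w | _] = X @^-1` [set j | A j])//.
  by rewrite -[_ @^-1` _]setTI; exact: measurable_funP.
rewrite -(expectation_indic P mA) unlock; apply: eq_integral => w _.
by rewrite /= indicE mem_setE.
Qed.

End UniformIndex.

(** * The random variables *)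

Section Encoding.
Context d (Omega : measurableType d) (R : realType) (P : probability Omega R).
Context (enc : nat -> seq bool) (U : nat -> {RV P >-> nat})
  (U_unif : forall n, (1 <= n)%N -> uniform_below n (U n)).

Lemma Z_pos n w : (0 < n)%N -> Z enc U n w = mu enc (U n w).
Proof. by case: n. Qed.

Lemma Z_prob n (A : pred nat) : (0 < n)%N ->
  P [set w | A (Z enc U n w)] =
  ((\sum_(0 <= j < n) (A (mu enc j))%:R) / n%:R : R)%:E.
Proof.
move=> n0; rewrite -(uniform_prob _ _ _ _ n (U n) (A \o mu enc) (U_unif n n0)).
by congr (P _); apply/seteqP; split => w /=; rewrite Z_pos.
Qed.

Lemma Z_expectation n (f : nat -> R) : (0 < n)%N -> (forall i, 0 <= f i) ->
  ('E_P[fun w => f (Z enc U n w)] =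
    ((\sum_(0 <= j < n) f (mu enc j)) / n%:R)%:E)%E.
Proof.
move=> n0 f0; rewrite unlock.
rewrite -(uniform_integral _ _ _ _ n (U n) (f \o mu enc) (U_unif n n0) (fun j => f0 _)).
by apply: eq_integral => w _ /=; rewrite Z_pos.
Qed.

Lemma Z_mean n : (0 < n)%N ->
  'E_P[(fun w => (Z enc U n w)%:R : R)]%E = (mean (mu enc) n)%:E.
Proof. by move=> n0; rewrite (Z_expectation n (fun i => i%:R)). Qed.

Lemma Z_variance n : (0 < n)%N ->
  'V_P[(fun w => (Z enc U n w)%:R : R)]%E = (var (mu enc) n)%:E.
Proof.
move=> n0; rewrite /variance unlock Z_mean//=.
rewrite -(Z_expectation n (fun i => (i%:R - mean (mu enc) n) ^+ 2))//.
by move=> i; exact: sqr_ge0.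
Qed.

(** The two values of [B] give the two terms on the right of the counting
identity in [splits_of_counts]. *)
Lemma splits_mu (B : {RV P >-> bool}) :
  distribution P B = bernoulli_prob (2^-1 : R) :> (set bool -> \bar R) ->
  (forall n, (1 <= n)%N -> independent_RVs P (Z enc U n) B) ->
  (forall n, (1 <= n)%N ->
     eq_in_distribution P (Z enc U (2 * n)%N) (fun w => (Z enc U n w + B w)%N)) ->
  splits (mu enc).
Proof.
have h01 : 0 <= (2^-1 : R) <= 1 by apply/andP; split; lra.
have half : unstable.onem (2^-1 : R) = 2^-1 by rewrite /unstable.onem; lra.
move=> B_bern B_indep Z_double; apply: (@splits_of_counts R) => n k n0.
have PB b : P (B @^-1` [set b]) = (2^-1 : R)%:E.
  have -> : P (B @^-1` [set b]) = distribution P B [set b] by [].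
  rewrite B_bern bernoulli_probE// half !diracE.
  have mem1 (a : bool) : (a \in [set b]) = (a == b).
    by apply/idP/eqP; rewrite inE.
  by rewrite !mem1; case: b {mem1}; rewrite /= ?mule1 ?mule0 ?adde0 ?add0e.
have mN (A : set nat) : measurable A by [].
have mZ (A : set nat) : measurable (Z enc U n @^-1` A).
  rewrite (_ : _ @^-1` A = U n @^-1` (mu enc @^-1` A)); last first.
    by apply/seteqP; split => w /=; rewrite Z_pos.
  by rewrite -[_ @^-1` _]setTI; exact: measurable_funP.
have mB (A : set bool) : measurable (B @^-1` A).
  by rewrite -[_ @^-1` _]setTI; exact: measurable_funP.
pose E (A : pred nat) b := Z enc U n @^-1` [set i | A i] `&` B @^-1` [set b].
have PE (A : pred nat) b :
    P (E A b) = ((\sum_(0 <= j < n) (A (mu enc j))%:R) / n%:R * 2^-1 : R)%:E.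
  rewrite EFinM -(PB b) -(Z_prob n A n0).
  exact: (B_indep n n0 [set i | A i] [set b]).
have PU : P (E (fun i => i == k) false `|` E (fun i => i.+1 == k) true) =
    (P (E (fun i => i == k) false) + P (E (fun i => i.+1 == k) true))%E.
  rewrite measureU//; [exact: measurableI|exact: measurableI|].
  by rewrite -subset0 => w /= [[_ e1] [_ e2]]; have := etrans (esym e1) e2.
have := Z_double n n0 [set k] (mN _).
have -> : (fun w => (Z enc U n w + B w)%N) @^-1` [set k] =
    E (fun i => i == k) false `|` E (fun i => i.+1 == k) true.
  apply/seteqP; split => w /=.
    move=> <-; rewrite /E; case Bw: (B w); [right|left]; split => //=.
      by rewrite addn1.
    by rewrite addn0.
  case Bw: (B w); case=> -[/eqP <- Bw']; rewrite ?addn1 ?addn0//.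
    by have := etrans (esym Bw) Bw'.
  by have := etrans (esym Bw) Bw'.
rewrite PU !PE.
have -> : Z enc U (2 * n)%N @^-1` [set k] = [set w | Z enc U (2 * n)%N w == k].
  by apply/seteqP; split => w /eqP.
rewrite (Z_prob (2 * n)%N (fun i => i == k)) ?muln_gt0//.
rewrite -EFinD => -[]; rewrite mul2n big_split /= => e.
have nR : n%:R != 0 :> R by rewrite pnatr_eq0 -lt0n.
apply: (@mulIf _ (n.*2%:R)^-1); first by rewrite invr_eq0 pnatr_eq0 double_eq0 -lt0n.
rewrite e -muln2 natrM; field; rewrite nR //.
Qed.

End Encoding.

Section Final.
Context {R : realType}.

Lemma local_gaussE (n : nat) (A x : R) : (0 < n)%N ->
  (0 < trunc_log 2 n)%N -> A / (2 * normal_peak 1) = 1 ->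
  A * expR (- x ^+ 2 / 2) / Num.sqrt (trunc_log 2 n)%:R = local_gauss n x.
Proof.
move=> n0 L0 A1; rewrite /local_gauss lamE//.
have w0 : 2 * normal_peak 1 != 0 :> R.
  by rewrite mulf_neq0// gt_eqF// normal_peak_gt0 ?oner_neq0.
have -> : A = 2 * normal_peak 1 by rewrite -[LHS](divfK w0) A1 mul1r.
have p0 := @pi_gt0 R.
have -> : normal_peak 1 = (Num.sqrt (2 * pi))^-1 :> R.
  by rewrite /normal_peak expr1n mul1r mulr_natl.
rewrite !sqrtrM ?ltW//.
have s20 : 0 < Num.sqrt 2 :> R by rewrite sqrtr_gt0.
have sp0 : 0 < Num.sqrt pi :> R by rewrite sqrtr_gt0.
have sL0 : 0 < Num.sqrt (trunc_log 2 n)%:R :> R by rewrite sqrtr_gt0 ltr0n.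
have -> : 2 * (Num.sqrt 2 * Num.sqrt pi)^-1 = Num.sqrt 2 / Num.sqrt pi :> R.
  rewrite -[X in X * _^-1](@sqr_sqrtr R 2)//.
  by field; rewrite !gt_eqF.
by field; rewrite !gt_eqF.
Qed.

End Final.

Theorem theorem4p1 (R : realType) (d : measure_display) (Omega : measurableType d)
    (P : probability Omega R)
    (enc : nat -> seq bool) (U : nat -> {RV P >-> nat}) (B : {RV P >-> bool})
    (enc_inj : injective enc)
    (mu0 : mu enc 0 = 0%N)
    (U_unif : forall n : nat, (1 <= n)%N -> uniform_below n (U n))
    (B_bern : distribution P B = bernoulli_prob (2^-1 : R) :> (set bool -> \bar R))
    (B_indep : forall n : nat, (1 <= n)%N -> independent_RVs P (Z enc U n) B)
    (Z_double : forall n : nat, (1 <= n)%N ->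
       eq_in_distribution P (Z enc U (2 * n)%N) (fun w => (Z enc U n w + B w)%N)) :
  (forall x : R,
     P [set w | ((Z enc U n w)%:R - lam R n / 2) / (Num.sqrt (lam R n) / 2) <= x]
       @[n --> \oo] --> normal_prob (0 : R) 1 `]-oo, x])
  /\
  (forall eps : nat -> R, eps n @[n --> \oo] --> (0 : R) ->
     exists C : R, \forall n \near \oo, forall x : R,
       `|x| <= eps n * lam R n `^ (6^-1) ->
       exists2 r : R,
         `|r| <= C * ((1 + `|x| ^+ 3) / Num.sqrt (lam R n)) &
         P [set w | (Z enc U n w)%:Z =
              Num.floor (lam R n / 2 + x * Num.sqrt (lam R n) / 2)]
         = (local_gauss n x * (1 + r))%:E)
  /\
  (exists G1 G2 : R -> R,
     [/\ bounded_fun G1, periodic G1 1, bounded_fun G2, periodic G2 1 &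
       forall n : nat, (1 <= n)%N ->
         ('E_P[(fun w => (Z enc U n w)%:R : R)] =
            (log2 (n%:R : R) / 2 + G1 (log2 (n%:R : R)))%:E)%E /\
         ('V_P[(fun w => (Z enc U n w)%:R : R)] =
            (log2 (n%:R : R) / 4 + G2 (log2 (n%:R : R)))%:E)%E]).
Proof.
have sm := splits_mu _ _ _ P enc U U_unif B B_bern B_indep Z_double.
have [A [C [A0 C0 LLT]]] := @local_limit_up_to_constant R.
have lll := LLT _ sm mu0.
have A1 := normalization _ A C A0 C0 sm mu0 lll.
split; last split.
- move=> x; rewrite Phi_fin.
  have clt := counting_clt _ A C x A0 C0 sm mu0 lll.
  have {}clt : (std_cdf (mu enc) n x)%:E @[n --> \oo] --> (Phi x)%:E.
    by apply/fine_cvgP; split; [exact: nearW | exact: clt].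
  apply: cvg_trans clt; apply: near_eq_cvg; near=> n.
  have n0 : (0 < n)%N by near: n; exists 1%N.
  have s1 : 1 <= Num.sqrt (trunc_log 2 n)%:R :> R.
    by near: n; exact: sqrt_trunc_log_infty.
  have s0 : 0 < Num.sqrt (trunc_log 2 n)%:R / 2 :> R.
    by rewrite divr_gt0// (lt_le_trans ltr01).
  rewrite /std_cdf /ecdf -(Z_prob _ _ _ P enc U U_unif n
    (fun i => (i%:R <= unscale (trunc_log 2 n) x :> R)%R) n0) lamE//.
  congr (P _); apply/seteqP; split => w /=;
    by rewrite ler_pdivrMr// lerBlDl.
- move=> eps eps0; exists C; near=> n => x xeps.
  have n0 : (0 < n)%N by near: n; exists 1%N.
  have s33 : 33 <= Num.sqrt (trunc_log 2 n)%:R :> R.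
    by near: n; exact: sqrt_trunc_log_infty.
  have eps1 : eps n <= 1.
    by near: n; apply: (cvgr_le _ eps0); exact: ltr01.
  rewrite lamE// in xeps *.
  set L := trunc_log 2 n in s33 xeps *.
  have s32 : 32 < Num.sqrt L%:R :> R by lra.
  have s0 : 0 < Num.sqrt L%:R :> R by lra.
  have L0 : (0 < L)%N.
    by move: s0; rewrite sqrtr_gt0 ltr0n.
  (* The range of [x] enters here: the cube of [L `^ 6^-1] is the square root of [L]. *)
  have x3 : `|x| ^+ 3 <= Num.sqrt L%:R.
    have xL : `|x| <= L%:R `^ 6^-1.
      by rewrite (le_trans xeps)// ler_piMl// powR_ge0.
    have -> : Num.sqrt L%:R = (L%:R `^ 6^-1) ^+ 3 :> R.
      rewrite -powR12_sqrt// -powR_mulrn ?powR_ge0// -powRrM; congr (_ `^ _).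
      by field.
    by rewrite lerXn2r ?nnegrE ?powR_ge0.
  pose y : R := L%:R / 2 + x * Num.sqrt L%:R / 2.
  have y0 : 0 <= y.
    have xs : `|x| <= Num.sqrt L%:R.
      have [x1|/ltW x1] := leP `|x| 1; first by rewrite (le_trans x1)//; lra.
      by apply: le_trans x3; rewrite exprSr ler_peMl// exprn_ege1.
    have -> : y = Num.sqrt L%:R / 2 * (Num.sqrt L%:R + x).
      have := sqr_sqrtr (ler0n R L); rewrite /y; move: (Num.sqrt _) => s <-.
      by field.
    rewrite mulr_ge0 ?divr_ge0 ?sqrtr_ge0//.
    by have := ler_norm (- x); rewrite normrN; lra.
  have /andP[k1 k2] := truncn_itv y0.
  set k := Num.truncn y in k1 k2.
  have yk : `|y - k%:R| <= 1.
    by move: k2; rewrite -natr1 ler_norml => k2; apply/andP; split; lra.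
  have [r rC cnt] := lll L n k x (trunc_log_bounds n n0) s32 x3 yk.
  exists r => //.
  rewrite -(local_gaussE n A x n0 L0 A1) -cnt /occurrences.
  rewrite -(Z_prob _ _ _ P enc U U_unif n (fun i => i == k) n0).
  have -> : Num.floor y = k%:Z.
    by apply: floor_def; rewrite -natr1 in k2; rewrite intrD k1.
  by congr (P _); apply/seteqP; split => w /= => [[->]|/eqP->].
- have g1b n : (0 < n)%N -> `|mean (mu enc) n - log2 n%:R / 2| <= 3 :> R.
    by move=> n0; case: (moments_bound (R := R) _ n sm mu0 n0).
  have g2b n : (0 < n)%N -> `|var (mu enc) n - log2 n%:R / 4| <= 9 :> R.
    by move=> n0; case: (moments_bound (R := R) _ n sm mu0 n0).
  have [|G1 [bG1 pG1 G1E]] := periodic_interpolation _ _ g1b.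
    by move=> n n0; rewrite mean_double// log2_double//; lra.
  have [|G2 [bG2 pG2 G2E]] := periodic_interpolation _ _ g2b.
    by move=> n n0; rewrite var_double// log2_double//; lra.
  exists G1, G2; split => // n n0.
  rewrite G1E// G2E// Z_mean// Z_variance//.
  by rewrite ![_ / _ + (_ - _)]addrC !subrK.
Unshelve. all: by end_near. Qed.
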